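(* Let $\lambda_i>0$, $i=1,\dots,k$, be any numbers, put $\lambda_{ij}=\lambda_i$ for all $j\ne i$, and assume that the testing problem is truncatable. Let $\psi$ be a stopping rule satisfying $$I_{\{l_m<f_\theta^m+R_m\}}\le\psi_m\le I_{\{l_m\le f_\theta^m+R_m\}}\quad\mu^m\text{-almost everywhere on } C_m^\psi\qquad( * )$$ for all $m=1,2,\dots$ (where $l_m$ and $R_m$ are built from these $\lambda_{ij}$), and let $\phi$ be any decision rule such that $$\phi_n^j\le I_{\left\{\sum_{i\ne j}\lambda_{i}f_{\theta_i}^n=\min_{1\le j'\le k}\sum_{i\ne j'}\lambda_i f_{\theta_i}^n\right\}}$$ for all $j=1,\dots,k$ and for all $n=1,2,\dots$. Then for any sequential test $(\psi',\phi')$ such that $$\beta_i(\psi',\phi')\le\beta_i(\psi,\phi)\quad\text{for all } i=1,\dots,k,\qquad( ** )$$ it holds that $$N(\psi')\ge N(\psi).\qquad( *** )$$ The inequality in $( *** )$ is strict if at least one of the inequalities in $( ** )$ is strict. If there are equalities in all of the inequalities in $( ** )$ and $( *** )$, then $\psi'$ satisfies $( * )$ for all $m=1,2,\dots$ as well (with $\psi'$ instead of $\psi$).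
   Context: Setting. Let $k\ge2$ and let $X_1,X_2,\dots$ be a discrete-time stochastic process with values in a measurable space $\mathcal X$, whose distribution $P_\vartheta$ depends on a parameter $\vartheta$. Let $\mu$ be a $\sigma$-finite measure on $\mathcal X$ and $\mu^n=\mu\otimes\cdots\otimes\mu$ ($n$ times). For every parameter value $\vartheta$ and every $n\ge 1$, under $P_\vartheta$ the vector $(X_1,\dots,X_n)$ has density $f_\vartheta^n(x_1,\dots,x_n)$ with respect to $\mu^n$ (in particular $\int f_\vartheta^{n+1}d\mu(x_{n+1})=f_\vartheta^n$ $\mu^n$-a.e.). Parameter values $\theta_1,\dots,\theta_k$ (the hypotheses $H_i:\theta=\theta_i$) and one more fixed parameter value $\theta$ (not necessarily one of the $\theta_i$) are given. For a function $F_n=F_n(x_1,\dots,x_n)$, $E_\vartheta F_n=E_\vartheta F_n(X_1,\dots,X_n)=\int F_n f^n_\vartheta\,d\mu^n$. A stopping rule is a sequence $\psi=(\psi_1,\psi_2,\dots)$ of measurable functions $\psi_n=\psi_n(x_1,\dots,x_n)$ with values in $[0,1]$. A decision rule is a sequence $\phi=(\phi_1,\phi_2,\dots)$, $\phi_n=(\phi_n^1,\dots,\phi_n^k)$, of measurable functions of $(x_1,\dots,x_n)$ with $\phi_n^i\ge0$ and $\sum_{i=1}^k\phi_n^i=1$. A sequential test is a pair $(\psi,\phi)$. The stopping time $\tau_\psi$ has distribution $P_\vartheta(\tau_\psi=n)=E_\vartheta(1-\psi_1)\cdots(1-\psi_{n-1})\psi_n$, and $P_\vartheta(\tau_\psi<\infty)=\sum_{n\ge1}P_\vartheta(\tau_\psi=n)$.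 Error probabilities: $\alpha_{ij}(\psi,\phi)=\sum_{n=1}^\infty E_{\theta_i}(1-\psi_1)\cdots(1-\psi_{n-1})\psi_n\phi_n^j$ and $\beta_i(\psi,\phi)=\sum_{j\ne i}\alpha_{ij}(\psi,\phi)$. Average sample number: $N(\psi)=E_\theta\tau_\psi=\sum_{n=1}^\infty nP_\theta(\tau_\psi=n)$ if $P_\theta(\tau_\psi<\infty)=1$, and $N(\psi)=\infty$ otherwise. Given $\lambda_{ij}$, put $l_n=\min_{1\le j\le k}\sum_{i\ne j}\lambda_{ij}f^n_{\theta_i}$ (in $\sum_{i\ne j}$, $j$ is fixed and $i$ runs over $\{1,\dots,k\}\setminus\{j\}$). The testing problem is called truncatable if $\int(1-\psi_1)\cdots(1-\psi_{n-1})\,l_n\,d\mu^n\to0$ as $n\to\infty$ for every stopping rule $\psi$ with $E_\theta\tau_\psi<\infty$. For $N\ge1$ put $V_N^N\equiv l_N$ and, recursively for $m=N-1,\dots,1$, $V_m^N=\min\{l_m,\ f_\theta^m+\int V_{m+1}^N(x_1,\dots,x_{m+1})\,d\mu(x_{m+1})\}$. For fixed $m$ the sequence $V_m^N$ is non-increasing in $N\ge m$; $V_m=\lim_{N\to\infty}V_m^N$. $R_m=R_m(x_1,\dots,x_m)=\int V_{m+1}(x_1,\dots,x_{m+1})\,d\mu(x_{m+1})$. $C_n^\psi=\{(x_1,\dots,x_n):(1-\psi_1(x_1))\cdots(1-\psi_{n-1}(x_1,\dots,x_{n-1}))>0\}$ (with the empty product equal to $1$ for $n=1$). $I_A$ is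 the indicator function of $A$. *)

(* Defs.v *)
From HB Require Import structures.
From mathcomp Require Import all_boot all_order all_algebra.
From mathcomp Require Import all_classical all_reals all_analysis.

Set Implicit Arguments.
Unset Strict Implicit.
Unset Printing Implicit Defensive.
Import Order.TTheory GRing.Theory Num.Theory.
Import numFieldNormedType.Exports.

Local Open Scope classical_set_scope.
Local Open Scope ring_scope.
Local Open Scope ereal_scope.

(* A sequence of functions F_n(x_1, ..., x_n), n = 1, 2, ...; the member of
   index 0 exists for typing reasons only and is never used. *)
Definition seqfun (T V : Type) := forall n : nat, n.-tuple T -> V.

Definition initial (T : Type) (m n : nat) (le_mn : (m <= n)%N)
    (x : n.-tuple T) : m.-tuple T :=
  [tuple tnth x (widen_ord le_mn j) | j < m].

Section product_power.
Context (d : measure_display) (T : measurableType d) (R : realType).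

Definition rcons_pair (n : nat) (p : n.-tuple T * T) : n.+1.-tuple T :=
  [tuple of rcons p.1 p.2].

Lemma measurable_rcons_pair (n : nat) :
  measurable_fun [set: n.-tuple T * T] (@rcons_pair n).
Proof.
apply/measurable_fun_tnthP => i.
have [lt_in|le_ni] := ltnP i n.
  rewrite (_ : _ \o _ =
      (fun x : n.-tuple T => tnth x (Ordinal lt_in)) \o fst).
    apply: measurableT_comp; last exact: measurable_fst.
    exact: measurable_tnth.
  apply/funext => -[x y] /=.
  by rewrite !(tnth_nth y) /= nth_rcons size_tuple lt_in.
rewrite (_ : _ \o _ = snd); first exact: measurable_snd.
apply/funext => -[x y] /=.
have i_n : i = n :> nat by apply/eqP; rewrite eqn_leq le_ni -ltnS ltn_ord.
by rewrite (tnth_nth y) /= nth_rcons size_tuple i_n ltnn eqxx.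
Qed.

Variable mu : {sigma_finite_measure set T -> \bar R}.

(* mu^n on T^n: mu^(n+1) is mu^n \x mu transported along the bijection
   ((x_1, ..., x_n), x_(n+1)) |-> (x_1, ..., x_(n+1)). *)
Fixpoint product_power (n : nat) : set (n.-tuple T) -> \bar R :=
  if n is m.+1 then
    pushforward (@product_power m \x mu) (@rcons_pair m)
  else \d_[tuple].

End product_power.
Arguments product_power {d T R} mu n _.

Section product_power_theory.
Context (d : measure_display) (T : measurableType d) (R : realType).
Variable mu : {sigma_finite_measure set T -> \bar R}.

Let product_power_measure (n : nat) :
  [/\ product_power mu n set0 = 0,
      (forall A, 0 <= product_power mu n A)
    & semi_sigma_additive (product_power mu n)].
Proof.
elim: n => [|n [pm0 pmge0 pmadd]].
  by split => //=; exact: measure_semi_sigma_additive.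
pose pm := isMeasure.Build _ _ _ (product_power mu n) pm0 pmge0 pmadd.
pose pM : {measure set (n.-tuple T) -> \bar R} :=
  HB.pack (product_power mu n) pm.
pose m2 := [the {measure set (n.-tuple T * T) -> \bar R} of pM \x mu].
split => [|A|F mF tF mUF].
- by rewrite /= /pushforward preimage_set0; exact: (measure0 m2).
- by rewrite /= /pushforward; exact: (measure_ge0 m2).
- rewrite /= /pushforward preimage_bigcup.
  apply: (@measure_semi_sigma_additive _ _ _ m2).
  + by move=> i; rewrite -[X in measurable X]setTI; exact: measurable_rcons_pair.
  + apply/trivIsetP => /= i j _ _ ij; rewrite -preimage_setI.
    by move/trivIsetP : tF => /(_ _ _ _ _ ij) ->//; rewrite preimage_set0.
  + rewrite -preimage_bigcup -[X in measurable X]setTI.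
    exact: measurable_rcons_pair.
Qed.

HB.instance Definition _ (n : nat) :=
  isMeasure.Build _ _ _ (product_power mu n)
    (let: And3 pm0 _ _ := product_power_measure n in pm0)
    (let: And3 _ pmge0 _ := product_power_measure n in pmge0)
    (let: And3 _ _ pmadd := product_power_measure n in pmadd).

Lemma product_power_setX (n : nat) (A : 'I_n -> set T) :
  (forall i, measurable (A i)) ->
  product_power mu n [set x | forall i, A i (tnth x i)] =
  \prod_(i < n) mu (A i).
Proof.
elim: n A => [|n IHn] A mA.
  by rewrite big_ord0 /= diracE mem_set//; case.
pose A' i := A (widen_ord (leqnSn n) i).
have mA' : measurable [set x : n.-tuple T | forall i, A' i (tnth x i)].
  rewrite (_ : [set x | _] =
      \bigcap_(i in [set: 'I_n]) (fun x : n.-tuple T => tnth x i) @^-1` A' i).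
    apply: fin_bigcap_measurable => // i _.
    rewrite -[X in measurable X]setTI.
    by apply: (@measurable_tnth _ T n i) => //; exact: mA.
  by apply/seteqP; split => x /= Ax i => [_|]; exact: Ax.
rewrite big_ord_recr /= -IHn//.
rewrite -(@product_measure1E _ _ _ _ _ (product_power mu n) mu)//.
rewrite /pushforward; congr (_ _); apply/seteqP; split => -[x y] /=.
- move=> Axy; split => [i|].
    have := Axy (widen_ord (leqnSn n) i).
    by rewrite !(tnth_nth y) /= nth_rcons size_tuple ltn_ord.
  have := Axy ord_max.
  by rewrite (tnth_nth y) /= nth_rcons size_tuple ltnn eqxx.
- move=> [Ax Ay] i; have [lt_in|le_ni] := ltnP i n.
    have := Ax (Ordinal lt_in).
    rewrite /A' (_ : widen_ord _ _ = i); last exact/val_inj.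
    by rewrite !(tnth_nth y) /= nth_rcons size_tuple lt_in.
  have -> : i = ord_max by apply/val_inj/eqP; rewrite eqn_leq le_ni -ltnS ltn_ord.
  by rewrite (tnth_nth y) /= nth_rcons size_tuple ltnn eqxx.
Qed.

End product_power_theory.

Unset Implicit Arguments.

Section model.
Context (d d' : measure_display) (Omega : measurableType d)
  (T : measurableType d') (R : realType).

(* (X_1, ..., X_n); the observation X_(i+1) is [X i]. *)
Definition observations (X : nat -> {mfun Omega >-> T}) (n : nat)
    (w : Omega) : n.-tuple T := [tuple X i w | i < n].

Definition has_density (d'' : measure_display) (S : measurableType d'')
    (P : probability Omega R) (Y : Omega -> S) (nu : set S -> \bar R)
    (g : S -> R) :=
  [/\ measurable_fun setT g, (forall x, (0 <= g x)%R) &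
      forall A, measurable A ->
        P (Y @^-1` A) = \int[nu]_(x in A) (g x)%:E].

End model.
Arguments observations {d d' Omega T} X n w.
Arguments has_density {d Omega R d'' S} P Y nu g.

Section sequential_test.
Context (d d' : measure_display) (Omega : measurableType d)
  (T : measurableType d') (R : realType).
Implicit Types (psi : seqfun T R) (k : nat).

Definition stopping_rule psi := forall n, (0 < n)%N ->
  measurable_fun setT (psi n) /\ (forall x, (0 <= psi n x <= 1)%R).

Definition decision_rule k (phi : 'I_k -> seqfun T R) :=
  forall n, (0 < n)%N ->
  [/\ (forall j, measurable_fun setT (phi j n)),
      (forall j x, (0 <= phi j n x)%R) &
      (forall x, (\sum_(j < k) phi j n x = 1)%R)].

(* (1 - psi_1(x_1)) ... (1 - psi_(n-1)(x_1, ..., x_(n-1))): the factor of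
   index 0 is skipped. *)
Definition continue_to psi : seqfun T R := fun n x =>
  (\prod_(i < n | (0 < i)%N) (1 - psi i (initial (ltnW (ltn_ord i)) x)))%R.

Definition C_set psi (n : nat) : set (n.-tuple T) :=
  [set x | (0 < continue_to psi n x)%R].

Variable X : nat -> {mfun Omega >-> T}.

Definition stopping_time_pmf (P : probability Omega R) psi (n : nat) : \bar R :=
  'E_P[fun w => let x := observations X n w in
         (continue_to psi n x * psi n x)%R].

Definition stopping_time_finite (P : probability Omega R) psi : \bar R :=
  \sum_(1 <= n <oo) stopping_time_pmf P psi n.

Definition average_sample_number (P : probability Omega R) psi : \bar R :=
  if stopping_time_finite P psi == 1 then
    \sum_(1 <= n <oo) n%:R%:E * stopping_time_pmf P psi n
  else +oo.

Definition alpha k (P : 'I_k -> probability Omega R) psi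
    (phi : 'I_k -> seqfun T R) (i j : 'I_k) : \bar R :=
  \sum_(1 <= n <oo)
    'E_(P i)[fun w => let x := observations X n w in
               (continue_to psi n x * psi n x * phi j n x)%R].

Definition beta k (P : 'I_k -> probability Omega R) psi
    (phi : 'I_k -> seqfun T R) (i : 'I_k) : \bar R :=
  \sum_(j < k | j != i) alpha k P psi phi i j.

End sequential_test.
Arguments stopping_rule {d' T R} psi.
Arguments decision_rule {d' T R k} phi.
Arguments continue_to {d' T R} psi n x.
Arguments C_set {d' T R} psi n _.
Arguments stopping_time_pmf {d d' Omega T R} X P psi n.
Arguments stopping_time_finite {d d' Omega T R} X P psi.
Arguments average_sample_number {d d' Omega T R} X P psi.
Arguments alpha {d d' Omega T R} X {k} P psi phi i j.
Arguments beta {d d' Omega T R} X {k} P psi phi i.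

Section optimal_stopping.
Context (d : measure_display) (T : measurableType d) (R : realType).
Variables (mu : {sigma_finite_measure set T -> \bar R}) (k : nat).
(* [fH i] stands for the densities under the hypothesis H_i, [f] for those
   under the parameter value at which the sample number is averaged. *)
Variables (fH : 'I_k -> seqfun T R) (f : seqfun T R).
Variable lambda : 'I_k -> 'I_k -> R.

Definition decision_loss (j : 'I_k) : seqfun T R := fun n x =>
  (\sum_(i < k | i != j) lambda i j * fH i n x)%R.

Definition l_ : seqfun T (\bar R) := fun n x =>
  \big[mine/+oo]_(j < k) (decision_loss j n x)%:E.

(* [V_rec r m] is V_m^(m + r), so [V_trunc N m] is V_m^N when m <= N. The
   values are extended real as the inner integral may be infinite on a null set. *)
Fixpoint V_rec (r m : nat) (x : m.-tuple T) : \bar R :=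
  if r is r'.+1 then
    mine (l_ m x) ((f m x)%:E +
                 \int[mu]_y V_rec r' m.+1 [tuple of rcons x y])
  else l_ m x.

Definition V_trunc (N : nat) : seqfun T (\bar R) := fun m x =>
  V_rec (N - m) m x.

Definition V_ : seqfun T (\bar R) := fun m x =>
  limn (fun N => V_trunc N m x).

Definition R_ : seqfun T (\bar R) := fun m x =>
  \int[mu]_y V_ m.+1 [tuple of rcons x y].

Definition stopping_condition (psi : seqfun T R) :=
  forall m, (0 < m)%N ->
  \forall x \ae product_power mu m, C_set psi m x ->
    (\1_[set z | (l_ m z < (f m z)%:E + R_ m z)%E] x <= psi m x
       <= \1_[set z | (l_ m z <= (f m z)%:E + R_ m z)%E] x)%R.

End optimal_stopping.
Arguments decision_loss {d T R k} fH lambda j n x.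
Arguments l_ {d T R k} fH lambda n x.
Arguments V_rec {d T R} mu {k} fH f lambda r m x.
Arguments V_trunc {d T R} mu {k} fH f lambda N n x.
Arguments V_ {d T R} mu {k} fH f lambda n x.
Arguments R_ {d T R} mu {k} fH f lambda n x.
Arguments stopping_condition {d T R} mu {k} fH f lambda psi.

Definition truncatable (d d' : measure_display) (Omega : measurableType d)
    (T : measurableType d') (R : realType) (X : nat -> {mfun Omega >-> T})
    (P : probability Omega R) (mu : {sigma_finite_measure set T -> \bar R})
    (k : nat) (fH : 'I_k -> seqfun T R) (lambda : 'I_k -> 'I_k -> R) :=
  forall psi : seqfun T R, stopping_rule psi ->
    average_sample_number X P psi < +oo ->
    (fun n => \int[product_power mu n]_x
                ((continue_to psi n x)%:E * l_ fH lambda n x)) @ \oo --> 0.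
Arguments truncatable {d d' Omega T R} X P mu {k} fH lambda.

(* Main.v *)
Require Import Defs.
From HB Require Import structures.
From mathcomp Require Import all_boot all_order all_algebra.
From mathcomp Require Import all_classical all_reals all_analysis.
From mathcomp Require Import measurable_realfun lra ring.

Import Order.TTheory GRing.Theory Num.Theory.
Import numFieldNormedType.Exports.

Local Open Scope classical_set_scope.
Local Open Scope ring_scope.
Local Open Scope ereal_scope.

(** Lagrange multipliers turn the constrained problem into an optimal stopping
    problem.  Write c_n for the probability of not having stopped before stage
    n given the observations, and put
    [L psi phi = N psi + sum_i lam_i * beta_i (psi, phi)].  It is enough to
    show that L has a lower bound, the same for all tests, that is attained by
    every test as described in the theorem, and that a test attaining it obeys
    the stopping condition: comparing L at two tests whose error probabilities
    are ordered then gives the three claims, because the multipliers are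
    positive and everything is finite at the optimum.

    The two parts of L are sums over the stages.  For the sample number this
    is the tail sum formula: N psi is the sum of the survival probabilities
    [E c_n] ([average_sample_number_survival]), which also holds when the test
    may fail to stop, both sides then being infinite.  For the errors, the
    weighted sum is the sum over n of the integrals of
    [c_n * psi_n * sum_j phi_n^j * loss_j], and [sum_j phi_n^j * loss_j] is at
    least l_n, with equality when phi_n only charges minimisers
    ([stopping_loss_le_weighted_error], [stopping_loss_eq_weighted_error]).

    What remains is a comparison of consecutive stages.  With
    [W n = \int c_n * V_n], the Bellman equation
    [V_n = min (l_n, f_n + R_n)] ([ae_V_recursion]) and the fact that a convex
    combination is at least the minimum give
    [W n <= E c_(n+1) + \int c_n * psi_n * l_n + W (n+1)],
    and equality holds exactly when psi_n puts its weight on the smaller of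
    l_n and f_n + R_n almost everywhere on C_n, which is the stopping
    condition at stage n ([continuation_value_le_one_step],
    [one_step_of_stopping_condition], [stopping_condition_of_one_step]).
    Telescoping from stage 1, where W does not depend on the rule, compares
    the cost with [1 + \int V_1].  If all steps are equalities the cost is at
    most this value ([cost_of_stopping_condition]).  For an arbitrary rule of
    finite sample number, truncatability makes the remainder W n vanish, so
    the cost is at least this value ([optimal_cost_le]); if it equals this
    value no step can lose anything ([stopping_condition_of_cost]). *)

Set Implicit Arguments.
Unset Strict Implicit.
Unset Printing Implicit Defensive.

(** * Integration against densities and product powers *)

Section integration.
Context d (S : measurableType d) (R : realType).

Import HBNNSimple.

(** The defining property of a density speaks of indicators only; it extends to
    nonnegative functions by monotone approximation with simple functions. *)
Lemma ge0_integral_density (nu rho : {measure set S -> \bar R}) (g : S -> R)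
    (h : S -> \bar R) :
  measurable_fun setT g -> (forall x, (0 <= g x)%R) ->
  (forall A, measurable A -> rho A = \int[nu]_(x in A) (g x)%:E) ->
  measurable_fun setT h -> (forall x, 0 <= h x) ->
  \int[rho]_x h x = \int[nu]_x (h x * (g x)%:E).
Proof.
move=> mg g0 rhoE mh h0.
pose h_ := nnsfun_approx measurableT mh.
have h_h x : (EFin \o h_^~ x) @ \oo --> h x.
  by apply: cvg_nnsfun_approx => // y _; exact: h0.
have mgE : measurable_fun setT (EFin \o g) by exact/measurable_EFinP.
have -> : \int[rho]_x h x = limn (fun n => \int[rho]_x (h_ n x)%:E).
  rewrite -monotone_convergence//.
  - by apply: eq_integral => x _; apply/esym/cvg_lim => //; exact: h_h.
  - by move=> n; exact/measurable_EFinP/measurable_funP.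
  - by move=> n x _; rewrite lee_fin.
  - by move=> x _ a b ab; rewrite lee_fin; exact/lefP/nd_nnsfun_approx.
have -> : \int[nu]_x (h x * (g x)%:E) =
    limn (fun n => \int[nu]_x ((h_ n x)%:E * (g x)%:E)).
  rewrite -monotone_convergence//.
  - apply: eq_integral => x _; apply/esym/cvg_lim => //.
    by apply: cvgeZr => //; exact: h_h.
  - move=> n; apply: emeasurable_funM => //.
    exact/measurable_EFinP/measurable_funP.
  - by move=> n x _; rewrite mule_ge0 ?lee_fin.
  - move=> x _ a b ab; rewrite lee_wpmul2r ?lee_fin//.
    exact/lefP/nd_nnsfun_approx.
congr (limn _); apply/funext => n.
have mind r : measurable_fun setT
    (fun x => (r * \1_(h_ n @^-1` [set r]) x)%:E).
  by apply/measurable_EFinP; exact: measurable_funM.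
(* The claim for a simple function reduces to indicators, where it is the
   definition of a density. *)
transitivity (\int[rho]_x
    (\sum_(y \in range (h_ n)) (y * \1_(h_ n @^-1` [set y]) x)%:E)).
  by apply: eq_integral => x _; rewrite fimfunE -fsumEFin.
transitivity (\int[nu]_x (\sum_(y \in range (h_ n))
    ((y * \1_(h_ n @^-1` [set y]) x)%:E * (g x)%:E))); last first.
  apply: eq_integral => x _.
  rewrite -ge0_mule_fsuml => [|y]; last exact: nnfun_muleindic_ge0.
  by rewrite fsumEFin// -fimfunE.
rewrite !ge0_integral_fsum//; last 3 first.
- move=> r; exact: emeasurable_funM.
- move=> y x _; rewrite mule_ge0 ?lee_fin//; exact: nnfun_muleindic_ge0.
- by move=> y x _; exact: nnfun_muleindic_ge0.
apply: eq_fsbigr => r _.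
have [r0|r0] := leP 0%R r; last first.
  rewrite !integral0_eq// => x _;
    rewrite preimage_nnfun0//= indic0 mulr0 ?mul0e//.
under eq_integral do rewrite EFinM.
under [RHS]eq_integral do rewrite EFinM -muleA.
rewrite ge0_integralZl//; last by apply/measurable_EFinP.
rewrite ge0_integralZl//; last 2 first.
- by apply: emeasurable_funM => //; exact/measurable_EFinP.
- by move=> x _; rewrite mule_ge0 ?lee_fin.
congr (_ * _); rewrite integral_indic// setIT rhoE//.
rewrite integral_mkcond epatch_indic; apply: eq_integral => x _.
by rewrite muleC.
Qed.

(** The converse of the monotonicity of the integral; finiteness of the smaller
    integral is what makes the nonnegative difference have integral 0. *)
Lemma ae_eq_of_le_of_integral_le (nu : {measure set S -> \bar R})
    (f g : S -> \bar R) :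
  measurable_fun setT f -> measurable_fun setT g ->
  (forall x, 0 <= f x) ->
  (\forall x \ae nu, f x <= g x) ->
  \int[nu]_x f x < +oo -> \int[nu]_x g x <= \int[nu]_x f x ->
  \forall x \ae nu, g x = f x.
Proof.
move=> mf mg f0 fg foo gf.
have mh : measurable_fun setT (fun x => g x - f x) by exact: emeasurable_funB.
have mah : measurable_fun setT (fun x => `|g x - f x|).
  exact: measurableT_comp.
have f_fin : \forall x \ae nu, f x \is a fin_num.
  apply: filterS (integrable_ae measurableT _) => [x|]; first exact.
  apply/integrableP; split => //.
  by under eq_integral do rewrite gee0_abs//.
have fhg : \forall x \ae nu, f x + `|g x - f x| = g x.
  apply: filterS2 fg f_fin => x fgx fx.
  by rewrite gee0_abs ?sube_ge0 ?fx// addeC subeK.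
have int_h : \int[nu]_x `|g x - f x| = 0.
  have f_fin_int : \int[nu]_x f x \is a fin_num.
    by rewrite ge0_fin_numE// integral_ge0.
  apply/eqP; rewrite eq_le integral_ge0// andbT.
  rewrite -(leeD2lE _ _ f_fin_int) adde0 -ge0_integralD//.
  rewrite (ae_eq_integral g)//; first exact: emeasurable_funD.
  by apply: filterS fhg => x + _.
have := (ae_eq_integral_abs nu measurableT mh).1 int_h.
apply: filterS2 fhg => x fhgx /= /(_ I) h0.
by rewrite -[LHS]fhgx h0 abse0 adde0.
Qed.

End integration.

Section product_power_integration.
Context d (T : measurableType d) (R : realType).
Variable mu : {sigma_finite_measure set T -> \bar R}.

Lemma measurable_initial m n (le_mn : (m <= n)%N) :
  measurable_fun setT (@initial T m n le_mn).
Proof.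
apply/measurable_fun_tnthP => j.
rewrite (_ : _ \o _ = fun x : n.-tuple T => tnth x (widen_ord le_mn j)).
  exact: measurable_tnth.
by apply/funext => x /=; rewrite tnth_mktuple.
Qed.

Lemma initial_rcons n (le_nS : (n <= n.+1)%N) (x : n.-tuple T) y :
  initial le_nS [tuple of rcons x y] = x.
Proof.
apply/eq_from_tnth => j; rewrite tnth_mktuple !(tnth_nth y) /= nth_rcons.
by rewrite size_tuple ltn_ord.
Qed.

Lemma initial_trans m n p (le_mn : (m <= n)%N) (le_np : (n <= p)%N)
    (x : p.-tuple T) :
  initial le_mn (initial le_np x) = initial (leq_trans le_mn le_np) x.
Proof.
apply/eq_from_tnth => j; rewrite !tnth_mktuple.
by congr (tnth x _); exact/val_inj.
Qed.

(** Required by Tonelli's theorem, which is applied to the last coordinate. *)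
Lemma sigma_finite_product_power n :
  sigma_finite [set: n.-tuple T] (product_power mu n).
Proof.
elim: n => [|n /sigma_finiteP[F [TF ndF Foo]]].
  exists (fun=> setT) => [|_]; first by rewrite bigcup_const//; exists 0%N.
  by split => //=; rewrite diracT ltry.
have /sigma_finiteP[G [TG ndG Goo]] := sigma_finiteT mu.
pose init (x : n.+1.-tuple T) := initial (leqnSn n) x.
pose last (x : n.+1.-tuple T) := tnth x ord_max.
have lastE (x : n.-tuple T) y : last [tuple of rcons x y] = y.
  by rewrite /last (tnth_nth y) /= nth_rcons size_tuple ltnn eqxx.
exists (fun i => init @^-1` F i `&` last @^-1` G i).
  apply/esym/seteqP; split => // x _.
  have [i _ Fi] : (\bigcup_i F i) (init x) by rewrite -TF.
  have [j _ Gj] : (\bigcup_i G i) (last x) by rewrite -TG.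
  exists (maxn i j) => //; split.
  - exact: (subsetPset _ _ (ndF _ _ (leq_maxl i j)) _ Fi).
  - exact: (subsetPset _ _ (ndG _ _ (leq_maxr i j)) _ Gj).
move=> i; have [mF Fioo] := Foo i; have [mG Gioo] := Goo i; split.
  apply: measurableI; rewrite -[X in measurable X]setTI.
  - exact: measurable_initial.
  - exact: measurable_tnth.
rewrite /= /pushforward (_ : _ @^-1` _ = F i `*` G i).
  by rewrite product_measure1E// lte_mul_pinfty// ge0_fin_numE.
by apply/seteqP; split => -[x y] /=; rewrite /init initial_rcons lastE.
Qed.

Lemma measurable_fun_rcons n (h : n.+1.-tuple T -> \bar R) :
  measurable_fun setT h ->
  measurable_fun setT (fun p : n.-tuple T * T => h [tuple of rcons p.1 p.2]).
Proof.
move=> mh; apply: (measurableT_comp mh); exact: measurable_rcons_pair.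
Qed.

Lemma measurable_fun_integral_rcons n (h : n.+1.-tuple T -> \bar R) :
  measurable_fun setT h -> (forall x, 0 <= h x) ->
  measurable_fun setT (fun x : n.-tuple T => \int[mu]_y h [tuple of rcons x y]).
Proof.
move=> mh h0.
apply: (@measurable_fun_fubini_tonelli_F _ _ _ _ _ mu
  (fun p : n.-tuple T * T => h [tuple of rcons p.1 p.2])) => //.
exact: measurable_fun_rcons.
Qed.

(** Tonelli's theorem: the last observation is integrated first, as in the
    definition of [R_]. *)
Lemma ge0_integral_product_power_rcons n (h : n.+1.-tuple T -> \bar R) :
  measurable_fun setT h -> (forall x, 0 <= h x) ->
  \int[product_power mu n.+1]_x h x =
  \int[product_power mu n]_x \int[mu]_y h [tuple of rcons x y].
Proof.
move=> mh h0.
pose sfP := Measure_isSigmaFinite.Build _ _ _ (product_power mu n)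
  (sigma_finite_product_power n).
pose mun : {sigma_finite_measure set (n.-tuple T) -> \bar R} :=
  HB.pack (product_power mu n) sfP.
transitivity (\int[product_power mu n \x mu]_p h (rcons_pair p)).
  apply: (@ge0_integral_pushforward _ _ _ _ _ (@rcons_pair _ T n) _
    (product_power mu n \x mu)) => //; exact: measurable_rcons_pair.
apply: (@fubini_tonelli1 _ _ _ _ _ mun mu
  (fun p : n.-tuple T * T => h [tuple of rcons p.1 p.2])) => //.
exact: measurable_fun_rcons.
Qed.

Context d' (Omega : measurableType d').

Lemma initial_observations (X : nat -> {mfun Omega >-> T}) m n
    (le_mn : (m <= n)%N) w :
  initial le_mn (observations X n w) = observations X m w.
Proof. by apply/eq_from_tnth => j; rewrite !tnth_mktuple. Qed.

Lemma measurable_observations (X : nat -> {mfun Omega >-> T}) n :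
  measurable_fun setT (observations X n).
Proof.
apply/measurable_fun_tnthP => j.
rewrite (_ : _ \o _ = X j) => [|]; first exact: measurable_funPT.
by apply/funext => x /=; rewrite tnth_mktuple.
Qed.

Lemma ge0_integral_observations (X : nat -> {mfun Omega >-> T})
    (P : probability Omega R) n (g : n.-tuple T -> R)
    (h : n.-tuple T -> \bar R) :
  has_density P (observations X n) (product_power mu n) g ->
  measurable_fun setT h -> (forall x, 0 <= h x) ->
  \int[P]_w h (observations X n w) =
  \int[product_power mu n]_x (h x * (g x)%:E).
Proof.
move=> [mg g0 PE] mh h0.
have mX := @measurable_observations X n.
rewrite -(@ge0_integral_density _ _ _ (product_power mu n)
  (pushforward P (observations X n)))//.
  by rewrite ge0_integral_pushforward.
Qed.

End product_power_integration.

(** * The tail sum formula *)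

Lemma eq_eseries_ge1 (R : realType) (f g : nat -> \bar R) :
  (forall n, (0 < n)%N -> f n = g n) ->
  \sum_(1 <= n <oo) f n = \sum_(1 <= n <oo) g n.
Proof.
move=> fg; apply/congr_lim/funext => m.
by apply: eq_big_nat => n /andP[n0 _]; exact: fg.
Qed.

(** In the application [s n] is the probability that the stopping time equals
    [n] and [t n] the probability that it is at least [n]. *)
Section tail_sum.
Context (R : realType).
Variables (s t : nat -> \bar R).
Hypotheses (s0 : forall n, 0 <= s n) (t0 : forall n, 0 <= t n).
Hypotheses (t1 : t 1%N = 1).
Hypothesis tS : forall n, (0 < n)%N -> t n = s n + t n.+1.

Let sum_recr (f : nat -> \bar R) m :
  \sum_(1 <= n < m.+2) f n = \sum_(1 <= n < m.+1) f n + f m.+1.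
Proof. exact: big_nat_recr. Qed.

(** So [t] need not tend to 0: its limit is the mass missing from [s]. *)
Let mass_split m : \sum_(1 <= n < m.+1) s n + t m.+1 = 1.
Proof.
elim: m => [|m IHm]; first by rewrite big_geq// add0e t1.
by rewrite sum_recr -addeA -tS.
Qed.

(** The boundary term is not known to vanish; when [s] has mass 1 it is
    absorbed by the tail of the series of [n * s n]. *)
Let summation_by_parts m :
  \sum_(1 <= n < m.+1) t n =
  \sum_(1 <= n < m.+1) n%:R%:E * s n + m%:R%:E * t m.+1.
Proof.
elim: m => [|m IHm]; first by rewrite !big_geq// mul0e adde0.
rewrite !sum_recr IHm -!addeA; congr (_ + _).
rewrite -ge0_muleDr// -tS// -[X in _ + X]mul1e -ge0_muleDl ?lee_fin//.
by rewrite -EFinD natr1.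
Qed.

Let ns0 n : 0 <= n%:R%:E * s n.
Proof. by rewrite mule_ge0 ?lee_fin. Qed.

(** The left-hand side is the expectation of a stopping time, with the
    convention that it is infinite if the stopping time may be infinite; the
    right-hand side needs no case distinction. *)
Lemma tail_sum_formula :
  (if \sum_(1 <= n <oo) s n == 1 then \sum_(1 <= n <oo) n%:R%:E * s n else +oo)
  = \sum_(1 <= n <oo) t n.
Proof.
have cvg_s := is_cvg_nneseries (P := xpredT) (N := 1%N) (fun n _ _ => s0 n).
have s_le1 : \sum_(1 <= n <oo) s n <= 1.
  apply: lime_le => //; apply: nearW => -[|m]; first by rewrite big_geq.
  by rewrite -(mass_split m) leeDl.
case: eqP => [s1|/eqP s1].
(* Mass 1: [t] is the tail of [s], and the boundary term [m * t m.+1] is at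
   most the tail of the series of [n * s n]. *)
- have tE m : t m.+1 = \sum_(m.+1 <= n <oo) s n.
    have sm_fin : \sum_(1 <= n < m.+1) s n \is a fin_num.
      rewrite ge0_fin_numE ?sume_ge0// (@le_lt_trans _ _ 1) ?ltry//.
      by rewrite -(mass_split m) leeDl.
    have := mass_split m; rewrite -s1 (nneseries_split 1 m)//.
    rewrite add1n => stE; apply/eqP.
    by rewrite eq_le; apply/andP; split; rewrite -(leeD2lE _ _ sm_fin) stE.
  have cvg_ns :=
    is_cvg_nneseries (P := xpredT) (N := 1%N) (fun n _ _ => ns0 n).
  have cvg_t := is_cvg_nneseries (P := xpredT) (N := 1%N) (fun n _ _ => t0 n).
  apply/eqP; rewrite eq_le; apply/andP; split.
  + apply: lime_le => //; apply: nearW => -[|m].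
      by rewrite big_geq// nneseries_ge0.
    apply: le_trans (nneseries_lim_ge m.+1 (fun n _ _ => t0 n)).
    by rewrite summation_by_parts leeDl// mule_ge0 ?lee_fin.
  + apply: lime_le => //; apply: nearW => -[|m].
      by rewrite big_geq// nneseries_ge0.
    rewrite summation_by_parts (nneseries_split 1 m)// add1n leeD2l//.
    rewrite tE -nneseriesZl// eseries_cond [leRHS]eseries_cond.
    apply: lee_nneseries => [n _ _|n /= mn]; first by rewrite mule_ge0 ?lee_fin.
    by rewrite lee_wpmul2r// lee_fin ler_nat ltnW.
(* Missing mass [delta]: all the [t n] are at least [delta], so their sum
   diverges. *)
- pose delta := 1 - \sum_(1 <= n <oo) s n.
  have s_fin : \sum_(1 <= n <oo) s n \is a fin_num.
    by rewrite ge0_fin_numE ?nneseries_ge0// (le_lt_trans s_le1) ?ltry.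
  have t_ge m : delta <= t m.+1.
    rewrite leeBlDr// addeC -[leLHS](mass_split m) leeD2r//.
    exact: nneseries_lim_ge.
  have delta0 : 0 < delta by rewrite sube_gt0// lt_neqAle s1.
  apply/esym/eqyP => A A0.
  have [e e0 deltaE] : exists2 e : R, (0 < e)%R & delta = e%:E.
    have delta_fin : delta \is a fin_num by rewrite fin_numB s_fin.
    by exists (fine delta); [rewrite -lte_fin fineK|rewrite fineK].
  have [m Am] : exists m, (A <= e *+ m)%R.
    exists (Num.bound (A / e)); rewrite -mulr_natl -ler_pdivrMr//.
    by rewrite ltW// archi_boundP// divr_ge0// ltW.
  apply: le_trans (nneseries_lim_ge m.+1 (fun n _ _ => t0 n)).
  apply: (@le_trans _ _ (\sum_(1 <= n < m.+1) e%:E)).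
    by rewrite sumEFin lee_fin sumr_const_nat subn1.
  rewrite -deltaE big_nat_cond [leRHS]big_nat_cond; apply: lee_sum => n.
  by case: n.
Qed.
End tail_sum.

(** * Stopping rules and survival probabilities *)

Section stopping_rules.
Context d (T : measurableType d) (R : realType).
Variables (psi : seqfun T R).
Arguments psi : clear implicits.

Lemma continue_to1 x : continue_to psi 1%N x = 1%R.
Proof. by rewrite /continue_to big_mkcond big_ord_recl big_ord0/= mulr1. Qed.

Lemma continue_toS n (x : n.+1.-tuple T) : (0 < n)%N ->
  continue_to psi n.+1 x =
  (continue_to psi n (initial (leqnSn n) x) *
   (1 - psi n (initial (leqnSn n) x)))%R.
Proof.
move=> n0; rewrite /continue_to big_mkcond big_ord_recr/= n0; congr (_ * _)%R.
  rewrite [RHS]big_mkcond; apply: eq_bigr => i _.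
  case: ifP => // _.
  rewrite initial_trans.
  by congr (1 - psi i (initial _ x))%R; exact: bool_irrelevance.
by congr (1 - psi n (initial _ x))%R; exact: bool_irrelevance.
Qed.

Hypothesis psi_rule : stopping_rule psi.

Lemma stopping_rule01 n x : (0 < n)%N -> (0 <= psi n x <= 1)%R.
Proof. by move=> /psi_rule[]. Qed.

Lemma continue_to01 n x : (0 <= continue_to psi n x <= 1)%R.
Proof.
have factor01 (i : 'I_n) : (0 < i)%N ->
    (0 <= 1 - psi i (initial (ltnW (ltn_ord i)) x) <= 1)%R.
  move=> i0; case/andP: (stopping_rule01 (initial (ltnW (ltn_ord i)) x) i0).
  by move=> psi_ge0 psi_le1; rewrite subr_ge0 psi_le1 lerBlDr lerDl.
rewrite /continue_to; apply/andP; split; last exact: prodr_ile1.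
by apply: prodr_ge0 => i i0; case/andP: (factor01 i i0).
Qed.

Lemma continue_to_ge0 n x : (0 <= continue_to psi n x)%R.
Proof. by case/andP: (continue_to01 x). Qed.

Lemma measurable_continue_to n : measurable_fun setT (continue_to psi n).
Proof.
rewrite /continue_to; under eq_fun do rewrite big_mkcond.
apply: measurable_prod => i _.
case: (0 < i)%N (@psi_rule i) => // /(_ isT)[mpsi _].
by apply: measurable_funB => //; apply: measurableT_comp => //;
  exact: measurable_initial.
Qed.

Lemma measurable_stop n : (0 < n)%N -> measurable_fun setT (psi n).
Proof. by move=> /psi_rule[]. Qed.

Definition stop_at : seqfun T R := fun n x =>
  (continue_to psi n x * psi n x)%R.
Arguments stop_at : clear implicits.

Lemma stop_at_ge0 n x : (0 < n)%N -> (0 <= stop_at n x)%R.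
Proof.
move=> n0; rewrite mulr_ge0 ?continue_to_ge0//.
by case/andP: (stopping_rule01 x n0).
Qed.

Lemma measurable_stop_at n : (0 < n)%N -> measurable_fun setT (stop_at n).
Proof.
move=> n0; apply: measurable_funM; first exact: measurable_continue_to.
exact: measurable_stop.
Qed.

Context d' (Omega : measurableType d') (X : nat -> {mfun Omega >-> T}).
Variable P : probability Omega R.

(** The probability that the stopping time is at least [n]: at stage [n] the
    decision whether to stop is still to be taken. *)
Definition survival n : \bar R :=
  \int[P]_w (continue_to psi n (observations X n w))%:E.

Lemma survival_ge0 n : 0 <= survival n.
Proof. by apply: integral_ge0 => w _; rewrite lee_fin continue_to_ge0. Qed.

Lemma survival1 : survival 1%N = 1.
Proof.
rewrite /survival; under eq_integral do rewrite continue_to1.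
by rewrite integral_cst// mul1e; exact: probability_setT.
Qed.

Lemma stopping_time_pmf_ge0 n : (0 < n)%N -> 0 <= stopping_time_pmf X P psi n.
Proof.
by move=> n0; apply: expectation_ge0 => w; exact: (stop_at_ge0 _ n0).
Qed.

(** Stage [n + 1] is reached by surviving until stage [n] and not stopping
    there; as this depends on the first [n] observations only, the two
    expectations are over the same variables. *)
Lemma survival_split n : (0 < n)%N ->
  survival n = stopping_time_pmf X P psi n + survival n.+1.
Proof.
move=> n0; rewrite /stopping_time_pmf /survival unlock -ge0_integralD//=.
- apply: eq_integral => w _; rewrite -EFinD continue_toS// initial_observations.
  by rewrite mulrBr mulr1 addrC subrK.
- by move=> w _; rewrite lee_fin stop_at_ge0.
- apply/measurable_EFinP; apply: (measurableT_comp (measurable_stop_at n0)).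
  exact: measurable_observations.
- by move=> w _; rewrite lee_fin continue_to_ge0.
- apply/measurable_EFinP; apply: (measurableT_comp (@measurable_continue_to _)).
  exact: measurable_observations.
Qed.

Lemma average_sample_number_survival :
  average_sample_number X P psi = \sum_(1 <= n <oo) survival n.
Proof.
(* At index 0 the pmf may be negative. *)
pose pmf n := if (0 < n)%N then stopping_time_pmf X P psi n else 0.
have pmfE n : (0 < n)%N -> pmf n = stopping_time_pmf X P psi n.
  by rewrite /pmf => ->.
rewrite -(@tail_sum_formula _ pmf survival).
- rewrite /average_sample_number /stopping_time_finite.
  rewrite -(eq_eseries_ge1 pmfE); case: ifP => // _.
  by apply: eq_eseries_ge1 => n n0; rewrite pmfE.
- rewrite /pmf => n; case: ifP => // n0; exact: stopping_time_pmf_ge0.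
- exact: survival_ge0.
- exact: survival1.
- by move=> n n0; rewrite pmfE// survival_split.
Qed.

End stopping_rules.
Arguments stop_at {d T R} psi n x.
Arguments survival {d T R} psi {d' Omega} X P n.

(** * Backward induction and the Bellman equation *)

Section backward_induction.
Context d (T : measurableType d) (R : realType).
Variables (mu : {sigma_finite_measure set T -> \bar R}) (k : nat).
Variables (fH : 'I_k -> seqfun T R) (f : seqfun T R).
Arguments fH : clear implicits.
Arguments f : clear implicits.
Variable lambda : 'I_k -> 'I_k -> R.
Hypothesis k_gt0 : (0 < k)%N.
Hypothesis lambda_ge0 : forall i j, (0 <= lambda i j)%R.
Hypothesis mfH : forall i n, (0 < n)%N -> measurable_fun setT (fH i n).
Hypothesis fH_ge0 : forall i n x, (0 < n)%N -> (0 <= fH i n x)%R.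
Hypothesis fH_lty : forall i n, (0 < n)%N ->
  \int[product_power mu n]_x (fH i n x)%:E < +oo.
Hypothesis mf : forall n, (0 < n)%N -> measurable_fun setT (f n).
Hypothesis f_ge0 : forall n x, (0 < n)%N -> (0 <= f n x)%R.

Local Notation loss := (decision_loss fH lambda).
Local Notation l_ := (l_ fH lambda).
Local Notation V_rec := (V_rec mu fH f lambda).
Local Notation V_trunc := (V_trunc mu fH f lambda).
Local Notation V_ := (V_ mu fH f lambda).
Local Notation R_ := (R_ mu fH f lambda).

Lemma decision_loss_ge0 j n x : (0 < n)%N -> (0 <= loss j n x)%R.
Proof. by move=> n0; apply: sumr_ge0 => i _; rewrite mulr_ge0// fH_ge0. Qed.

Lemma measurable_decision_loss j n : (0 < n)%N ->
  measurable_fun setT (loss j n).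
Proof.
move=> n0; rewrite /decision_loss.
under eq_fun do rewrite big_mkcond.
apply: measurable_sum => i; case: (i != j) => //.
by apply: measurable_funM => //; exact: mfH.
Qed.

Lemma l_le_decision_loss j n x : l_ n x <= (loss j n x)%:E.
Proof. by rewrite /Defs.l_ (bigD1 j)//= ge_min lexx. Qed.

Lemma l_ge0 n x : (0 < n)%N -> 0 <= l_ n x.
Proof.
move=> n0; rewrite /Defs.l_; elim/big_ind : _ => // [a b a0 b0|j _].
  by rewrite le_min a0.
by rewrite lee_fin decision_loss_ge0.
Qed.

Lemma l_fin_num n x : (0 < n)%N -> l_ n x \is a fin_num.
Proof.
move=> n0; rewrite ge0_fin_numE ?l_ge0//.
exact: le_lt_trans (l_le_decision_loss (Ordinal k_gt0) x) (ltry _).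
Qed.

Lemma measurable_l n : (0 < n)%N -> measurable_fun setT (l_ n).
Proof.
move=> n0; rewrite /Defs.l_; elim: (index_enum _) => [|j s IHs].
  by under eq_fun do rewrite big_nil; exact: measurable_cst.
under eq_fun do rewrite big_cons.
apply: measurable_mine => //.
by apply/measurable_EFinP; exact: measurable_decision_loss.
Qed.

(** Bounding the minimum by one fixed loss is enough; this makes [l_] an
    integrable bound for all the truncated values. *)
Lemma integral_l_lty n : (0 < n)%N ->
  \int[product_power mu n]_x l_ n x < +oo.
Proof.
move=> n0; pose j := Ordinal k_gt0.
apply: (@le_lt_trans _ _
    (\int[product_power mu n]_x
       (\sum_(i < k) (lambda i j)%:E * (fH i n x)%:E))).
  apply: ge0_le_integral => //.
  - by move=> x _; exact: l_ge0.
  - exact: measurable_l.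
  - apply: emeasurable_sum => i; apply: emeasurable_funM => //.
    by apply/measurable_EFinP; exact: mfH.
  - move=> x _; apply: le_trans (l_le_decision_loss j x) _.
    rewrite /decision_loss -sumEFin big_mkcond; apply: lee_sum => i _.
    by case: ifP => _; rewrite ?EFinM// mule_ge0 ?lee_fin ?fH_ge0.
rewrite ge0_integral_sum//.
- apply: lte_sum_pinfty => i _.
  rewrite ge0_integralZl ?lte_mul_pinfty ?lee_fin//; first exact: fH_lty.
  - by apply/measurable_EFinP; exact: mfH.
  - by move=> x _; rewrite lee_fin fH_ge0.
- move=> i; apply: emeasurable_funM => //.
  by apply/measurable_EFinP; exact: mfH.
- by move=> i x _; rewrite mule_ge0 ?lee_fin ?fH_ge0.
Qed.

Lemma V_rec_ge0 r m x : (0 < m)%N -> 0 <= V_rec r m x.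
Proof.
elim: r m x => [|r IHr] m x m0 /=; first exact: l_ge0.
rewrite le_min l_ge0//= adde_ge0 ?lee_fin ?f_ge0//.
by apply: integral_ge0 => y _; exact: IHr.
Qed.

Lemma measurable_V_rec r m : (0 < m)%N -> measurable_fun setT (V_rec r m).
Proof.
elim: r m => [|r IHr] m m0 /=; first exact: measurable_l.
apply: measurable_mine; first exact: measurable_l.
apply: emeasurable_funD; first by apply/measurable_EFinP; exact: mf.
apply: measurable_fun_integral_rcons; first exact: IHr.
by move=> x; exact: V_rec_ge0.
Qed.

Lemma measurable_tail m (h : m.+1.-tuple T -> \bar R) (x : m.-tuple T) :
  measurable_fun setT h ->
  measurable_fun setT (fun y => h [tuple of rcons x y]).
Proof.
move=> mh.
apply: (@measurable_fun_pair2 _ _ _ _ _ _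
  (fun p : m.-tuple T * T => h [tuple of rcons p.1 p.2])).
exact: measurable_fun_rcons.
Qed.

(** One more stage can only help; the inequality at the horizon propagates
    backwards since the recursion is monotone. *)
Lemma V_recS_le r m x : (0 < m)%N -> V_rec r.+1 m x <= V_rec r m x.
Proof.
elim: r m x => [|r IHr] m x m0; first by rewrite /= ge_min lexx.
rewrite [leLHS]/= [leRHS]/= le_min !ge_min lexx/= leeD2l ?orbT//.
apply: ge0_le_integral => //.
- by move=> y _; exact: (@V_rec_ge0 r.+1).
- exact: (measurable_tail x (@measurable_V_rec r.+1 m.+1 isT)).
- exact: (measurable_tail x (@measurable_V_rec r m.+1 isT)).
- by move=> y _; exact: IHr.
Qed.

Lemma V_trunc_ge0 N m x : (0 < m)%N -> 0 <= V_trunc N m x.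
Proof. exact: V_rec_ge0. Qed.

Lemma measurable_V_trunc N m : (0 < m)%N -> measurable_fun setT (V_trunc N m).
Proof. exact: measurable_V_rec. Qed.

Lemma V_trunc_recursion N m x : (m < N)%N ->
  V_trunc N m x =
  mine (l_ m x) ((f m x)%:E + \int[mu]_y V_trunc N m.+1 [tuple of rcons x y]).
Proof. by move=> mN; rewrite /Defs.V_trunc -(subnSK mN). Qed.

Lemma nonincreasing_V_trunc m x : (0 < m)%N ->
  nonincreasing_seq (fun N => V_trunc N m x).
Proof.
move=> m0 N M NM; rewrite /Defs.V_trunc.
rewrite -(subnK (leq_sub2r m NM)); elim: (_ - _)%N => // r IHr.
by rewrite addSn (le_trans _ IHr)// V_recS_le.
Qed.

Lemma cvg_V_trunc m x : (0 < m)%N ->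
  (fun N => V_trunc N m x) @ \oo --> V_ m x.
Proof.
by move=> m0; apply: ereal_nonincreasing_is_cvgn; exact: nonincreasing_V_trunc.
Qed.

Lemma V_le_V_trunc N m x : (0 < m)%N -> V_ m x <= V_trunc N m x.
Proof.
move=> m0; apply: (cvge_to_le (@cvg_V_trunc m x m0)).
by exists N => // M NM; exact: nonincreasing_V_trunc.
Qed.

Lemma V_trunc_le_l N m x : (0 < m)%N -> V_trunc N m x <= l_ m x.
Proof.
move=> m0; rewrite (_ : l_ m x = V_trunc 0 m x) ?sub0n//.
exact: nonincreasing_V_trunc.
Qed.

Lemma V_le_l m x : (0 < m)%N -> V_ m x <= l_ m x.
Proof.
by move=> m0; exact: le_trans (V_le_V_trunc 0 x m0) (V_trunc_le_l _ _ m0).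
Qed.

Lemma V_ge0 m x : (0 < m)%N -> 0 <= V_ m x.
Proof.
move=> m0; apply: (cvge_to_ge (@cvg_V_trunc m x m0)).
by apply: nearW => N; exact: V_trunc_ge0.
Qed.

Lemma measurable_V m : (0 < m)%N -> measurable_fun setT (V_ m).
Proof.
move=> m0; apply: (emeasurable_fun_cvg (fun N => V_trunc N m)) => [N|x _].
  exact: measurable_V_trunc.
exact: cvg_V_trunc.
Qed.

Lemma R_ge0 m x : 0 <= R_ m x.
Proof. by apply: integral_ge0 => y _; exact: V_ge0. Qed.

Lemma measurable_R m : measurable_fun setT (R_ m).
Proof.
apply: measurable_fun_integral_rcons; first exact: measurable_V.
by move=> x; exact: V_ge0.
Qed.

(** The truncated values decrease, so monotone convergence does not apply; they
    are dominated by [l_], whose integral over the next observation is finite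
    for almost all pasts. *)
Lemma cvg_integral_V_trunc m (x : m.-tuple T) :
  \int[mu]_y l_ m.+1 [tuple of rcons x y] < +oo ->
  (fun N => \int[mu]_y V_trunc N m.+1 [tuple of rcons x y]) @ \oo --> R_ m x.
Proof.
move=> l_lty.
have tail_ge0 (y : T) : 0 <= l_ m.+1 [tuple of rcons x y] by exact: l_ge0.
have l_int : mu.-integrable setT (fun y => l_ m.+1 [tuple of rcons x y]).
  apply/integrableP; split.
    exact: (measurable_tail x (@measurable_l m.+1 isT)).
  by under eq_integral do rewrite gee0_abs//.
have [] := @dominated_convergence _ _ _ mu setT measurableT
  (fun N y => V_trunc N m.+1 [tuple of rcons x y])
  (fun y => V_ m.+1 [tuple of rcons x y])
  (fun y => l_ m.+1 [tuple of rcons x y]) _ _ _ l_int _ => //.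
- by move=> N; exact: (measurable_tail x (@measurable_V_trunc N m.+1 isT)).
- exact: (measurable_tail x (@measurable_V m.+1 isT)).
- by apply: aeW => y _; exact: cvg_V_trunc.
- apply: aeW => y N _; rewrite gee0_abs ?V_trunc_ge0//.
  exact: V_trunc_le_l.
Qed.

(** The limit and the minimum commute here because the truncated values are
    monotone in the horizon: each inequality follows by comparing with a single
    large horizon. *)
Lemma V_recursion m (x : m.-tuple T) : (0 < m)%N ->
  \int[mu]_y l_ m.+1 [tuple of rcons x y] < +oo ->
  V_ m x = mine (l_ m x) ((f m x)%:E + R_ m x).
Proof.
move=> m0 l_lty; apply/eqP; rewrite eq_le; apply/andP; split.
- rewrite le_min V_le_l//=.
  have cvg_fR : (fun N => (f m x)%:E +
      \int[mu]_y V_trunc N m.+1 [tuple of rcons x y]) @ \oo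
      --> (f m x)%:E + R_ m x.
    apply: cvgeD; [|exact: cvg_cst|exact: cvg_integral_V_trunc].
    exact: fin_num_adde_defr.
  apply: (cvge_to_ge cvg_fR); exists m.+1 => // N /= mN.
  rewrite (le_trans (V_le_V_trunc N x m0))// V_trunc_recursion//.
  by rewrite ge_min lexx orbT.
- apply: (cvge_to_ge (@cvg_V_trunc m x m0)).
  exists m.+1 => // N /= mN; rewrite V_trunc_recursion// le_min !ge_min lexx/=.
  rewrite leeD2l ?orbT//; apply: ge0_le_integral => //.
  + by move=> y _; exact: V_ge0.
  + exact: (measurable_tail x (@measurable_V m.+1 isT)).
  + exact: (measurable_tail x (@measurable_V_trunc N m.+1 isT)).
  + by move=> y _; exact: V_le_V_trunc.
Qed.

Lemma ae_V_recursion m : (0 < m)%N ->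
  \forall x \ae product_power mu m,
    V_ m x = mine (l_ m x) ((f m x)%:E + R_ m x).
Proof.
move=> m0.
pose L (x : m.-tuple T) := \int[mu]_y l_ m.+1 [tuple of rcons x y].
have L0 x : 0 <= L x by apply: integral_ge0 => y _; exact: l_ge0.
have iL : (product_power mu m).-integrable setT L.
  apply/integrableP; split.
    apply: measurable_fun_integral_rcons; first exact: measurable_l.
    by move=> x; exact: l_ge0.
  under eq_integral do rewrite gee0_abs//.
  rewrite -ge0_integral_product_power_rcons; first exact: integral_l_lty.
  - exact: measurable_l.
  - by move=> x; exact: l_ge0.
apply: filterS (integrable_ae measurableT iL) => x /(_ I) Lx.
by apply: V_recursion => //; rewrite -/(L x) -ge0_fin_numE.
Qed.

End backward_induction.

(** * Telescoping inequalities and two-point mixtures *)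

Section telescoping.
Context (R : realType) (a W : nat -> \bar R).
Hypothesis a0 : forall n, (0 < n)%N -> 0 <= a n.
Hypothesis W0 : forall n, (0 < n)%N -> 0 <= W n.

Let a_ge0 N n : (0 < N)%N -> (N <= n)%N -> 0 <= a n.
Proof. by move=> N0 Nn; exact/a0/(leq_trans N0). Qed.

Let sum_recr N m :
  \sum_(N <= n < N + m.+1) a n = \sum_(N <= n < N + m) a n + a (N + m)%N.
Proof. by rewrite addnS; apply: big_nat_recr; exact: leq_addr. Qed.

(** The remainder [W] can be dropped as it is nonnegative, so no convergence is
    needed in this direction. *)
Lemma series_le_of_step_ge :
  (forall n, (0 < n)%N -> a n + W n.+1 <= W n) ->
  \sum_(1 <= n <oo) a n <= W 1%N.
Proof.
move=> step; apply: lime_le.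
  by apply: is_cvg_nneseries => n n1 _; exact: a0.
suff partial m : \sum_(1 <= n < 1 + m) a n + W (1 + m)%N <= W 1%N.
  apply: nearW => -[|m]; first by rewrite big_geq// W0.
  by apply: le_trans (partial m); rewrite leeDl// W0.
elim: m => [|m]; first by rewrite big_geq// add0e.
by apply: le_trans; rewrite sum_recr -addeA leeD2l// step.
Qed.

Hypothesis stepW : forall n, (0 < n)%N -> W n <= a n + W n.+1.

Let partial_le N m : (0 < N)%N ->
  W N <= \sum_(N <= n < N + m) a n + W (N + m)%N.
Proof.
move=> N0; elim: m => [|m IHm]; first by rewrite addn0 big_geq// add0e.
apply: le_trans IHm _; rewrite sum_recr -addeA leeD2l// addnS stepW//.
by rewrite addn_gt0 N0.
Qed.

Hypothesis W_cvg0 : W @ \oo --> 0.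

(** Stated from an arbitrary start [N], as [step_ge_of_series_le] applies it to
    the tail after a given step. *)
Lemma le_series_of_step_le N : (0 < N)%N -> W N <= \sum_(N <= n <oo) a n.
Proof.
move=> N0; pose A := \sum_(N <= n <oo) a n.
have cvgA : (fun m => A + W m) @ \oo --> A + 0.
  apply: cvgeD => //; [exact: fin_num_adde_defl|exact: cvg_cst].
rewrite -[leRHS]adde0; apply: (cvge_to_ge cvgA); exists N => // m /= Nm.
apply: le_trans (partial_le (m - N) N0) _; rewrite subnKC// leeD2r//.
by apply: nneseries_lim_ge => n Nn _; exact: a_ge0 Nn.
Qed.

(** A strict loss at one step could not be recovered: the steps before it give
    at least [W 1 - W n] and those after it at least [W n.+1]. *)
Lemma step_ge_of_series_le n : (0 < n)%N ->
  \sum_(1 <= n <oo) a n <= W 1%N -> W 1%N < +oo -> a n + W n.+1 <= W n.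
Proof.
case: n => // n _ aW Woo.
have a1 k : (1 <= k)%N -> 0 <= a k by exact: a0.
pose s := \sum_(1 <= j < 1 + n) a j.
have s_fin : s \is a fin_num.
  rewrite ge0_fin_numE; last first.
    by rewrite /s big_seq sume_ge0// => i; rewrite mem_index_iota => /andP[/a0].
  apply: le_lt_trans Woo; apply: le_trans aW.
  by apply: nneseries_lim_ge => i i1 _; exact: a0.
rewrite -(leeD2lE _ _ s_fin).
apply: (@le_trans _ _ (W 1%N)); last by rewrite -add1n; exact: partial_le.
apply: le_trans aW; rewrite (nneseries_split 1 n.+1)// sum_recr -addeA.
rewrite leeD2l// add1n leeD2l//; exact: le_series_of_step_le.
Qed.

End telescoping.

Section two_point_mixture.
Context (R : realType) (a b : \bar R) (p : R).
Hypotheses (a_fin : a \is a fin_num) (b0 : 0 <= b) (p01 : (0 <= p <= 1)%R).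

Lemma mine_le_mixture : mine a b <= p%:E * a + (1 - p)%:E * b.
Proof.
case/andP: p01 => p0 p1; move: a b a_fin b0 => [r| |]// [s| |]// _ _.
- rewrite -EFin_min lee_fin ge_min.
  have [rs|sr] := leP r s; apply/orP; [left|right]; rewrite -subr_ge0.
    have : (0 <= (1 - p) * (s - r))%R by rewrite mulr_ge0 ?subr_ge0.
    lra.
  have : (0 <= p * (r - s))%R by rewrite mulr_ge0// subr_ge0 ltW.
  lra.
- rewrite (min_idPl (leey _)); have [p_lt1|p_ge1] := ltP p 1%R.
    by rewrite gt0_muley ?lte_fin ?subr_gt0// addey// leey.
  have -> : p = 1%R by apply/eqP; rewrite eq_le p1.
  by rewrite subrr mul0e adde0 mul1e.
Qed.

(** The mixture is minimal iff its weight avoids the larger of the two values;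
    when they agree every weight is allowed.  The value [+oo] for [b] needs no
    exception since [0 * +oo = 0]. *)
Lemma mixture_eq_mineP :
  p%:E * a + (1 - p)%:E * b = mine a b <->
  (((a < b)%E)%:R <= p <= ((a <= b)%E)%:R)%R.
Proof.
case/andP: p01 => p0 p1; move: a b a_fin b0 => [r| |]// [s| |]// _ _.
- rewrite -EFin_min lte_fin lee_fin; split.
    move=> [] mixE; have [rs|sr|rs] := ltgtP r s; rewrite /= ?p0 ?p1 ?andbT//.
    + rewrite minElt rs in mixE.
      rewrite leNgt; apply/negP => p_lt1.
      have : (0 < (1 - p) * (s - r))%R by rewrite mulr_gt0 ?subr_gt0.
      lra.
    + rewrite minElt ltNge (ltW sr)/= in mixE.
      rewrite leNgt; apply/negP => p_gt0.
      have : (0 < p * (r - s))%R by rewrite mulr_gt0 ?subr_gt0.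
      lra.
  have [rs|sr|->] := ltgtP r s => /andP[pl pu]; congr EFin.
  + by have -> : p = 1%R by [apply/eqP; rewrite eq_le pu]; lra.
  + by have -> : p = 0%R by [apply/eqP; rewrite eq_le pu]; lra.
  + lra.
- rewrite ltry leey/= (min_idPl (leey _)); split.
    rewrite p1 andbT => mixE; rewrite leNgt; apply/negP => p_lt1.
    by move: mixE; rewrite gt0_muley ?lte_fin ?subr_gt0// addey.
  move=> /andP[p_ge1 _]; have -> : p = 1%R by apply/eqP; rewrite eq_le p1.
  by rewrite subrr mul0e adde0 mul1e.
Qed.

End two_point_mixture.

(** * Optimal stopping *)

Section optimal_stopping.
Context d d' (Omega : measurableType d) (T : measurableType d') (R : realType).
Variables (X : nat -> {mfun Omega >-> T}).
Variables (mu : {sigma_finite_measure set T -> \bar R}) (k : nat).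
Variables (PH : 'I_k -> probability Omega R) (P : probability Omega R).
Variables (fH : 'I_k -> seqfun T R) (f : seqfun T R).
Arguments fH : clear implicits.
Arguments f : clear implicits.
Variable lambda : 'I_k -> 'I_k -> R.
Hypothesis k_gt0 : (0 < k)%N.
Hypothesis lambda_ge0 : forall i j, (0 <= lambda i j)%R.
Hypothesis fH_density : forall i n, (0 < n)%N ->
  has_density (PH i) (observations X n) (product_power mu n) (fH i n).
Hypothesis f_density : forall n, (0 < n)%N ->
  has_density P (observations X n) (product_power mu n) (f n).

Local Notation l_ := (l_ fH lambda).
Local Notation V_ := (V_ mu fH f lambda).
Local Notation R_ := (R_ mu fH f lambda).

Let mfH i n : (0 < n)%N -> measurable_fun setT (fH i n).
Proof. by move=> /fH_density-/(_ i)[]. Qed.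

Let fH_ge0 i n x : (0 < n)%N -> (0 <= fH i n x)%R.
Proof. by move=> /fH_density-/(_ i)[]. Qed.

Let fH_lty i n : (0 < n)%N -> \int[product_power mu n]_x (fH i n x)%:E < +oo.
Proof.
move=> /fH_density-/(_ i)[_ _ /(_ setT measurableT) <-].
by rewrite preimage_setT [ltLHS]probability_setT ltry.
Qed.

Let mf n : (0 < n)%N -> measurable_fun setT (f n).
Proof. by move=> /f_density[]. Qed.

Let f_ge0 n x : (0 < n)%N -> (0 <= f n x)%R.
Proof. by move=> /f_density[]. Qed.

Let l0 n x : (0 < n)%N -> 0 <= l_ n x.
Proof. exact: l_ge0. Qed.

Let ml n : (0 < n)%N -> measurable_fun setT (l_ n).
Proof. exact: measurable_l. Qed.

Let V0 n x : (0 < n)%N -> 0 <= V_ n x.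
Proof. exact: V_ge0. Qed.

Let mV n : (0 < n)%N -> measurable_fun setT (V_ n).
Proof. exact: measurable_V. Qed.

Let R0 n x : 0 <= R_ n x.
Proof. exact: R_ge0. Qed.

Let mR n : measurable_fun setT (R_ n).
Proof. exact: measurable_R. Qed.

Definition stopping_condition_at (psi : seqfun T R) m :=
  \forall x \ae product_power mu m, C_set psi m x ->
    (\1_[set z | (l_ m z < (f m z)%:E + R_ m z)%E] x <= psi m x
       <= \1_[set z | (l_ m z <= (f m z)%:E + R_ m z)%E] x)%R.

Section one_rule.
Variable psi : seqfun T R.
Arguments psi : clear implicits.
Hypothesis psi_rule : stopping_rule psi.

Local Notation c := (continue_to psi).
Local Notation surv := (survival psi X P).

(** The contribution of stage [n] to the weighted error probabilities under the
    best decision rule. *)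
Definition stopping_loss n : \bar R :=
  \int[product_power mu n]_x ((stop_at psi n x)%:E * l_ n x).

(** The limit over the horizon of the least further cost beyond that of having
    reached stage [n], for a test that has followed [psi] so far. *)
Definition continuation_value n : \bar R :=
  \int[product_power mu n]_x ((c n x)%:E * V_ n x).

Let c0 n x : (0 <= c n x)%R.
Proof. exact: continue_to_ge0. Qed.

Let mc n : measurable_fun setT (fun x => (c n x)%:E).
Proof. by apply/measurable_EFinP; exact: measurable_continue_to. Qed.

Let mpsi n : (0 < n)%N -> measurable_fun setT (fun x => (psi n x)%:E).
Proof. by move=> n0; apply/measurable_EFinP; exact: measurable_stop. Qed.

Let q0 n x : (0 < n)%N -> (0 <= 1 - psi n x)%R.
Proof.
by move=> n0; rewrite subr_ge0; case/andP: (stopping_rule01 psi_rule x n0).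
Qed.

Let cq0 n x : (0 < n)%N -> (0 <= c n x * (1 - psi n x))%R.
Proof. by move=> n0; rewrite mulr_ge0// q0. Qed.

Let mcq n : (0 < n)%N ->
  measurable_fun setT (fun x => (c n x * (1 - psi n x))%:E).
Proof.
move=> n0; apply/measurable_EFinP; apply: measurable_funM.
  exact: measurable_continue_to.
by apply: measurable_funB => //; exact: measurable_stop.
Qed.

Lemma stopping_loss_ge0 n : (0 < n)%N -> 0 <= stopping_loss n.
Proof.
move=> n0; apply: integral_ge0 => x _.
by rewrite mule_ge0 ?l0// lee_fin stop_at_ge0.
Qed.

Lemma continuation_value_ge0 n : (0 < n)%N -> 0 <= continuation_value n.
Proof.
by move=> n0; apply: integral_ge0 => x _; rewrite mule_ge0 ?V0 ?lee_fin.
Qed.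

Lemma continuation_value1 :
  continuation_value 1%N = \int[product_power mu 1]_x V_ 1%N x.
Proof. by apply: eq_integral => x _; rewrite continue_to1 mul1e. Qed.

Lemma continuation_value_lty n : (0 < n)%N -> continuation_value n < +oo.
Proof.
move=> n0.
apply: le_lt_trans (integral_l_lty k_gt0 lambda_ge0 mfH fH_ge0 fH_lty n0).
apply: ge0_le_integral => //.
- by move=> x _; rewrite mule_ge0 ?V0 ?lee_fin.
- by apply: emeasurable_funM; [exact: mc|exact: (mV n0)].
- exact: ml.
- move=> x _; apply: (@le_trans _ _ (1 * V_ n x)).
    rewrite lee_wpmul2r ?V0// lee_fin.
    by case/andP: (continue_to01 psi_rule x).
  by rewrite mul1e; exact: (V_le_l mu lambda_ge0 mfH fH_ge0 mf f_ge0).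
Qed.

(** The event that stage [n + 1] is reached depends on [n] observations only,
    so its probability can be computed with the density [f n]. *)
Lemma survivalS n : (0 < n)%N ->
  surv n.+1 =
  \int[product_power mu n]_x ((c n x * (1 - psi n x))%:E * (f n x)%:E).
Proof.
move=> n0.
rewrite -(@ge0_integral_observations _ _ _ _ _ _ X P _ _
  (fun x => (c n x * (1 - psi n x))%:E) (f_density n0)).
- by apply: eq_integral => w _; rewrite continue_toS// initial_observations.
- exact: mcq.
- by move=> x; rewrite lee_fin cq0.
Qed.

Lemma continuation_valueS n : (0 < n)%N ->
  continuation_value n.+1 =
  \int[product_power mu n]_x ((c n x * (1 - psi n x))%:E * R_ n x).
Proof.
move=> n0; rewrite /continuation_value ge0_integral_product_power_rcons.
- apply: eq_integral => x _; rewrite -ge0_integralZl//.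
  + apply: eq_integral => y _.
    by rewrite continue_toS// initial_rcons.
  + exact: (measurable_tail x (@mV n.+1 isT)).
  + by move=> y _; exact: V0.
  + by rewrite lee_fin cq0.
- by apply: emeasurable_funM; [exact: mc|exact: (@mV n.+1 isT)].
- by move=> x; rewrite mule_ge0 ?V0 ?lee_fin.
Qed.

(** The conditional further cost at stage [n] if [psi] is followed there and
    what comes afterwards is valued by [V_]. *)
Let mixture n (x : n.-tuple T) : \bar R :=
  (psi n x)%:E * l_ n x + (1 - psi n x)%:E * ((f n x)%:E + R_ n x).
Arguments mixture : clear implicits.

Let mixture_ge0 n (x : n.-tuple T) : (0 < n)%N -> 0 <= mixture n x.
Proof.
move=> n0; rewrite adde_ge0// mule_ge0 ?lee_fin ?l0 ?q0//.
- by case/andP: (stopping_rule01 psi_rule x n0).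
- by rewrite adde_ge0// lee_fin f_ge0.
Qed.

Let measurable_mixture n : (0 < n)%N -> measurable_fun setT (mixture n).
Proof.
move=> n0; apply: emeasurable_funD; apply: emeasurable_funM => //.
- exact: mpsi.
- exact: ml.
- apply/measurable_EFinP; apply: measurable_funB => //.
  exact: measurable_stop.
- apply: emeasurable_funD; last exact: mR.
  by apply/measurable_EFinP; exact: mf.
Qed.

Lemma one_step_cost n : (0 < n)%N ->
  surv n.+1 + stopping_loss n + continuation_value n.+1 =
  \int[product_power mu n]_x ((c n x)%:E * mixture n x).
Proof.
move=> n0; rewrite survivalS// continuation_valueS// addeAC addeC.
have cq_ge0 x : 0 <= (c n x * (1 - psi n x))%:E by rewrite lee_fin cq0.
have mcq_n := mcq n0.
have mfE : measurable_fun setT (fun x => (f n x)%:E).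
  by apply/measurable_EFinP; exact: mf.
have mcR := emeasurable_funM mcq_n (@mR n).
have mcf := emeasurable_funM mcq_n mfE.
have cf_ge0 x : 0 <= (c n x * (1 - psi n x))%:E * (f n x)%:E.
  by apply: mule_ge0; rewrite // lee_fin f_ge0.
have cR_ge0 x : 0 <= (c n x * (1 - psi n x))%:E * R_ n x.
  by apply: mule_ge0 => //; exact: R0.
rewrite -ge0_integralD// -ge0_integralD//; last 4 first.
- by move=> x _; rewrite mule_ge0 ?l0// lee_fin stop_at_ge0.
- apply: emeasurable_funM; last exact: ml.
  by apply/measurable_EFinP; exact: measurable_stop_at.
- by move=> x _; exact: adde_ge0.
- exact: emeasurable_funD.
apply: eq_integral => x _.
rewrite -ge0_muleDr ?lee_fin ?f_ge0// [RHS]ge0_muleDr; last 2 first.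
- by rewrite mule_ge0 ?l0// lee_fin; case/andP: (stopping_rule01 psi_rule x n0).
- rewrite mule_ge0 ?lee_fin ?q0//.
  by apply: adde_ge0; [rewrite lee_fin f_ge0|exact: R0].
by rewrite !muleA -!EFinM.
Qed.

Let ae_mixture_ge n : (0 < n)%N ->
  \forall x \ae product_power mu n,
    (c n x)%:E * V_ n x <= (c n x)%:E * mixture n x.
Proof.
move=> n0.
have := ae_V_recursion k_gt0 lambda_ge0 mfH fH_ge0 fH_lty mf f_ge0 n0.
apply: filterS => x ->; rewrite lee_wpmul2l ?lee_fin//.
apply: mine_le_mixture; first exact: l_fin_num.
- by rewrite adde_ge0 ?lee_fin ?f_ge0.
- exact: stopping_rule01.
Qed.

Let mcV n : (0 < n)%N -> measurable_fun setT (fun x => (c n x)%:E * V_ n x).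
Proof. by move=> n0; apply: emeasurable_funM; [exact: mc|exact: (mV n0)]. Qed.

Let mcM n : (0 < n)%N ->
  measurable_fun setT (fun x => (c n x)%:E * mixture n x).
Proof.
by move=> n0; apply: emeasurable_funM; [exact: mc|exact: measurable_mixture].
Qed.

Let cV0 n x : (0 < n)%N -> 0 <= (c n x)%:E * V_ n x.
Proof. by move=> n0; rewrite mule_ge0 ?lee_fin ?V0. Qed.

Let cM0 n x : (0 < n)%N -> 0 <= (c n x)%:E * mixture n x.
Proof. by move=> n0; rewrite mule_ge0 ?lee_fin ?mixture_ge0. Qed.

(** By the Bellman equation [V_] is the smaller of the two costs between which
    [psi] randomises. *)
Lemma continuation_value_le_one_step n : (0 < n)%N ->
  continuation_value n <=
  surv n.+1 + stopping_loss n + continuation_value n.+1.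
Proof.
move=> n0; rewrite one_step_cost//; apply: ae_ge0_le_integral => //.
- by move=> x _; exact: cV0.
- exact: mcV.
- by move=> x _; exact: cM0.
- exact: mcM.
- by apply: filterS (ae_mixture_ge n0) => x + _.
Qed.

(** Where the test has certainly stopped both sides vanish, which is why the
    stopping condition is only imposed on [C_set]. *)
Let mixture_eqP n x : (0 < n)%N ->
  V_ n x = mine (l_ n x) ((f n x)%:E + R_ n x) ->
  (c n x)%:E * mixture n x = (c n x)%:E * V_ n x <->
  (C_set psi n x ->
    (\1_[set z | (l_ n z < (f n z)%:E + R_ n z)%E] x <= psi n x
       <= \1_[set z | (l_ n z <= (f n z)%:E + R_ n z)%E] x)%R).
Proof.
move=> n0 VE.
have f0 : 0 <= (f n x)%:E by rewrite lee_fin f_ge0.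
have indicE' (b : n.-tuple T -> bool) : \1_[set z | b z] x = (b x)%:R :> R.
  rewrite indicE; congr (_%:R); congr nat_of_bool.
  by apply/idP/idP; rewrite inE.
have mixP := mixture_eq_mineP
  (l_fin_num k_gt0 lambda_ge0 fH_ge0 x n0)
  (adde_ge0 f0 (R0 x)) (stopping_rule01 psi_rule x n0).
rewrite /C_set /= !indicE' VE.
have := c0 x; rewrite le_eqVlt => /predU1P[<-|c_gt0].
  by split=> [_|_]; rewrite ?ltxx// !mul0e.
split=> [cmix _|/(_ c_gt0)/mixP mixE]; last by rewrite /mixture mixE.
apply/mixP; move/(congr1 (fun z => ((c n x)^-1)%:E * z)): cmix.
by rewrite !muleA -!EFinM mulVf ?gt_eqF// !mul1e.
Qed.

Lemma stopping_condition_of_one_step n : (0 < n)%N ->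
  surv n.+1 + stopping_loss n + continuation_value n.+1 <=
    continuation_value n ->
  stopping_condition_at psi n.
Proof.
move=> n0; rewrite one_step_cost// => le_cV.
have := ae_V_recursion k_gt0 lambda_ge0 mfH fH_ge0 fH_lty mf f_ge0 n0.
have := ae_eq_of_le_of_integral_le (mcV n0) (mcM n0)
  (fun x => cV0 x n0) (ae_mixture_ge n0) (continuation_value_lty n0) le_cV.
by apply: filterS2 => x eqx VE; apply/mixture_eqP.
Qed.

Lemma one_step_of_stopping_condition n : (0 < n)%N ->
  stopping_condition_at psi n ->
  surv n.+1 + stopping_loss n + continuation_value n.+1 = continuation_value n.
Proof.
move=> n0 cond; rewrite one_step_cost//; apply: ae_eq_integral => //.
- exact: mcM.
- exact: mcV.
have := ae_V_recursion k_gt0 lambda_ge0 mfH fH_ge0 fH_lty mf f_ge0 n0.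
by apply: filterS2 cond => x condx VE _; apply/mixture_eqP.
Qed.

(** The first stage is always reached; pairing the survival probability of
    stage [n + 1] with the loss at stage [n] gives the terms that the one-step
    comparison controls. *)
Lemma survival_stopping_loss_series :
  average_sample_number X P psi + \sum_(1 <= n <oo) stopping_loss n =
  1 + \sum_(1 <= n <oo) (surv n.+1 + stopping_loss n).
Proof.
have surv0 n : 0 <= surv n by exact: survival_ge0.
rewrite average_sample_number_survival// nneseriesD//; last first.
  by move=> n n0 _; exact: stopping_loss_ge0.
rewrite addeA; congr (_ + _).
rewrite (nneseries_split 1 1)// big_nat1 survival1; congr (_ + _).
rewrite -(nneseries_addn 2)// -(nneseries_addn (f := fun n => surv n.+1) 1)//.
by apply: eq_eseriesr => n _; rewrite addn2 addn1.
Qed.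

Let step_ge0 n : (0 < n)%N -> 0 <= surv n.+1 + stopping_loss n.
Proof. by move=> n0; rewrite adde_ge0 ?survival_ge0 ?stopping_loss_ge0. Qed.

(** In particular such a rule has a finite sample number, the right-hand side
    being finite. *)
Lemma cost_of_stopping_condition :
  (forall n, (0 < n)%N -> stopping_condition_at psi n) ->
  average_sample_number X P psi + \sum_(1 <= n <oo) stopping_loss n <=
  1 + \int[product_power mu 1]_x V_ 1%N x.
Proof.
move=> cond; rewrite survival_stopping_loss_series leeD2l//.
rewrite -continuation_value1; apply: series_le_of_step_ge => //.
- exact: continuation_value_ge0.
- by move=> n n0; rewrite one_step_of_stopping_condition//; exact: cond.
Qed.

Hypothesis trunc : truncatable X P mu fH lambda.

Let cvg_continuation_value : average_sample_number X P psi < +oo ->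
  continuation_value @ \oo --> 0.
Proof.
move=> Noo; apply: (@squeeze_cvge _ _ _ _ (cst 0) _ (fun n =>
    \int[product_power mu n]_x ((c n x)%:E * l_ n x))) => //; last 2 first.
- exact: cvg_cst.
- exact: trunc.
exists 1%N => // n /= n0; rewrite continuation_value_ge0//=.
apply: ge0_le_integral => //.
- by move=> x _; exact: cV0.
- exact: mcV.
- by apply: emeasurable_funM; [exact: mc|exact: ml].
- move=> x _; rewrite lee_wpmul2l ?lee_fin//.
  exact: (V_le_l mu lambda_ge0 mfH fH_ge0 mf f_ge0).
Qed.

(** Truncatability only speaks of rules with a finite sample number, but for the
    others the cost is infinite. *)
Lemma optimal_cost_le :
  1 + \int[product_power mu 1]_x V_ 1%N x <=
  average_sample_number X P psi + \sum_(1 <= n <oo) stopping_loss n.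
Proof.
have [Noo|] := ltP (average_sample_number X P psi) +oo; last first.
  rewrite leye_eq => /eqP ->; rewrite addye ?leey//.
  rewrite gt_eqF// (@lt_le_trans _ _ 0)// nneseries_ge0// => n n0 _.
  exact: stopping_loss_ge0.
rewrite survival_stopping_loss_series leeD2l// -continuation_value1.
apply: le_series_of_step_le => //.
- exact: continuation_value_le_one_step.
- exact: cvg_continuation_value.
Qed.

Lemma stopping_condition_of_cost :
  average_sample_number X P psi + \sum_(1 <= n <oo) stopping_loss n <=
    1 + \int[product_power mu 1]_x V_ 1%N x ->
  forall n, (0 < n)%N -> stopping_condition_at psi n.
Proof.
move=> cost n n0.
have V1oo := continuation_value_lty (isT : 0 < 1)%N.
have Noo : average_sample_number X P psi < +oo.
  apply: (@le_lt_trans _ _ (1 + \int[product_power mu 1]_x V_ 1%N x)).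
    apply: le_trans cost; rewrite leeDl// nneseries_ge0// => m m0 _.
    exact: stopping_loss_ge0.
  by rewrite lte_add_pinfty ?ltry// -continuation_value1.
apply: stopping_condition_of_one_step => //.
apply: (@step_ge_of_series_le _ (fun n => surv n.+1 + stopping_loss n)
  continuation_value) => //.
- exact: continuation_value_le_one_step.
- exact: cvg_continuation_value.
- move: cost; rewrite survival_stopping_loss_series -continuation_value1.
  by rewrite leeD2lE.
Qed.

End one_rule.
End optimal_stopping.

(** * The weighted error probabilities *)

Section error_cost.
Context d d' (Omega : measurableType d) (T : measurableType d') (R : realType).
Variables (X : nat -> {mfun Omega >-> T}).
Variables (mu : {sigma_finite_measure set T -> \bar R}) (k : nat).
Variables (PH : 'I_k -> probability Omega R) (fH : 'I_k -> seqfun T R).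
Arguments fH : clear implicits.
Variable lambda : 'I_k -> 'I_k -> R.
Hypothesis k_gt0 : (0 < k)%N.
Hypothesis lambda_ge0 : forall i j, (0 <= lambda i j)%R.
Hypothesis fH_density : forall i n, (0 < n)%N ->
  has_density (PH i) (observations X n) (product_power mu n) (fH i n).
Variables (psi : seqfun T R) (phi : 'I_k -> seqfun T R).
Arguments psi : clear implicits.
Arguments phi : clear implicits.
Hypotheses (psi_rule : stopping_rule psi) (phi_rule : decision_rule phi).

Local Notation loss := (decision_loss fH lambda).
Local Notation l_ := (l_ fH lambda).

Let fH_ge0 i n x : (0 < n)%N -> (0 <= fH i n x)%R.
Proof. by move=> /fH_density-/(_ i)[]. Qed.

Let mfH i n : (0 < n)%N -> measurable_fun setT (fH i n).
Proof. by move=> /fH_density-/(_ i)[]. Qed.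

Let phi_ge0 j n x : (0 < n)%N -> (0 <= phi j n x)%R.
Proof. by move=> /phi_rule[]. Qed.

Let sum_phi n x : (0 < n)%N -> (\sum_(j < k) phi j n x = 1)%R.
Proof. by move=> /phi_rule[]. Qed.

(** Weights that vanish on the diagonal, so that sums over [i != j] become sums
    over all pairs. *)
Let w i j : R := if i != j then lambda i j else 0%R.

Let w_ge0 i j : (0 <= w i j)%R.
Proof. by rewrite /w; case: ifP. Qed.

Let lossE j n x : loss j n x = (\sum_(i < k) w i j * fH i n x)%R.
Proof.
rewrite /decision_loss big_mkcond; apply: eq_bigr => i _.
by rewrite /w; case: ifP => _; rewrite ?mul0r.
Qed.

(** The probability under [H_i] of stopping at stage [n] and accepting [H_j]. *)
Let accept i j n : \bar R :=
  \int[product_power mu n]_x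
    ((stop_at psi n x * phi j n x)%:E * (fH i n x)%:E).

Let stop_phi_ge0 j n x : (0 < n)%N -> (0 <= stop_at psi n x * phi j n x)%R.
Proof. by move=> n0; rewrite mulr_ge0 ?phi_ge0// stop_at_ge0. Qed.

Let measurable_stop_phi j n : (0 < n)%N ->
  measurable_fun setT (fun x => (stop_at psi n x * phi j n x)%:E).
Proof.
move=> n0; apply/measurable_EFinP; apply: measurable_funM.
  exact: measurable_stop_at.
by case: (phi_rule n0) => mphi _ _; exact: mphi.
Qed.

Let accept_ge0 i j n : (0 < n)%N -> 0 <= accept i j n.
Proof.
move=> n0; apply: integral_ge0 => x _.
by rewrite mule_ge0 ?lee_fin ?fH_ge0 ?stop_phi_ge0.
Qed.

Let alpha_accept i j :
  alpha X PH psi phi i j = \sum_(1 <= n <oo) accept i j n.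
Proof.
apply: eq_eseries_ge1 => n n0; rewrite unlock /accept.
rewrite -(@ge0_integral_observations _ _ _ _ _ _ X (PH i) _ _
  (fun x => (stop_at psi n x * phi j n x)%:E) (@fH_density i _ n0))//.
- exact: measurable_stop_phi.
- by move=> x; rewrite lee_fin stop_phi_ge0.
Qed.

Lemma alpha_ge0 i j : 0 <= alpha X PH psi phi i j.
Proof.
by rewrite alpha_accept nneseries_ge0// => n n0 _; exact: accept_ge0.
Qed.

Lemma beta_ge0 i : 0 <= beta X PH psi phi i.
Proof. by apply: sume_ge0 => j _; exact: alpha_ge0. Qed.

Let stage_cost n : (0 < n)%N ->
  \sum_(i < k) \sum_(j < k) (w i j)%:E * accept i j n =
  \int[product_power mu n]_x
    ((stop_at psi n x)%:E * (\sum_(j < k) phi j n x * loss j n x)%:E).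
Proof.
move=> n0.
pose g i j (x : n.-tuple T) : \bar R :=
  (w i j)%:E * ((stop_at psi n x * phi j n x)%:E * (fH i n x)%:E).
have g_ge0 i j x : 0 <= g i j x.
  by rewrite !mule_ge0 ?lee_fin ?stop_phi_ge0 ?fH_ge0.
have m_afH i j : measurable_fun setT
    (fun x => (stop_at psi n x * phi j n x)%:E * (fH i n x)%:E).
  apply: emeasurable_funM; first exact: measurable_stop_phi.
  by apply/measurable_EFinP; exact: mfH.
have mg i j : measurable_fun setT (g i j) by exact: emeasurable_funM.
transitivity (\sum_(i < k) \sum_(j < k) \int[product_power mu n]_x g i j x).
  apply: eq_bigr => i _; apply: eq_bigr => j _.
  rewrite ge0_integralZl ?lee_fin// => x _.
  by rewrite mule_ge0 ?lee_fin ?stop_phi_ge0 ?fH_ge0.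
transitivity (\int[product_power mu n]_x \sum_(i < k) \sum_(j < k) g i j x).
  rewrite ge0_integral_sum//.
  - by apply: eq_bigr => i _; rewrite ge0_integral_sum.
  - by move=> i; apply: emeasurable_sum => j.
  - by move=> i x _; exact: sume_ge0.
apply: eq_integral => x _; rewrite exchange_big/= -EFinM mulr_sumr -sumEFin.
apply: eq_bigr => j _; rewrite lossE mulrA mulr_sumr -sumEFin.
by apply: eq_bigr => i _; rewrite /g -!EFinM; congr EFin; ring.
Qed.

Lemma weighted_error_series :
  \sum_(i < k) \sum_(j < k | i != j) (lambda i j)%:E * alpha X PH psi phi i j =
  \sum_(1 <= n <oo) \int[product_power mu n]_x
    ((stop_at psi n x)%:E * (\sum_(j < k) phi j n x * loss j n x)%:E).
Proof.
(* At index 0 the integrals [accept] may be negative. *)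
pose a i j n := if (0 < n)%N then accept i j n else 0.
have a_ge0 i j n : 0 <= a i j n.
  by rewrite /a; case: ifP => // n0; exact: accept_ge0.
transitivity (\sum_(i < k) \sum_(j < k) \sum_(1 <= n <oo) (w i j)%:E * a i j n).
  apply: eq_bigr => i _; rewrite big_mkcond; apply: eq_bigr => j _.
  rewrite nneseriesZl// -(@eq_eseries_ge1 _ (accept i j)); last first.
    by move=> n n0; rewrite /a n0.
  by rewrite alpha_accept /w; case: ifP => _; rewrite ?mul0e.
transitivity (\sum_(i < k) \sum_(1 <= n <oo) \sum_(j < k) (w i j)%:E * a i j n).
  apply: eq_bigr => i _; rewrite nneseries_sum// => j n _.
  by rewrite mule_ge0 ?lee_fin.
rewrite -nneseries_sum; last first.
  by move=> i n _; apply: sume_ge0 => j _; rewrite mule_ge0 ?lee_fin.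
by apply: eq_eseries_ge1 => n n0; rewrite -stage_cost// /a n0.
Qed.

Let l_mean n x : (0 < n)%N ->
  l_ n x = (\sum_(j < k) phi j n x * fine (l_ n x))%:E.
Proof.
move=> n0; rewrite -mulr_suml sum_phi// mul1r fineK//.
exact: l_fin_num.
Qed.

Let l_le_mean_loss n x : (0 < n)%N ->
  l_ n x <= (\sum_(j < k) phi j n x * loss j n x)%:E.
Proof.
move=> n0; rewrite [leLHS]l_mean// lee_fin; apply: ler_sum => j _.
rewrite ler_wpM2l ?phi_ge0// -lee_fin fineK ?l_fin_num//.
exact: l_le_decision_loss.
Qed.

(** The weights [phi j n x] add up to 1, and an average of the losses is at
    least their minimum. *)
Lemma stopping_loss_le_weighted_error :
  \sum_(1 <= n <oo) stopping_loss mu fH lambda psi n <=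
  \sum_(i < k) \sum_(j < k | i != j)
    (lambda i j)%:E * alpha X PH psi phi i j.
Proof.
rewrite weighted_error_series eseries_cond [leRHS]eseries_cond.
apply: lee_nneseries => [n _ n0|n n0].
  by apply: integral_ge0 => x _; rewrite mule_ge0 ?l_ge0// lee_fin stop_at_ge0.
have stop_ge0 x : 0 <= (stop_at psi n x)%:E by rewrite lee_fin stop_at_ge0.
have mstop : measurable_fun setT (fun x => (stop_at psi n x)%:E).
  by apply/measurable_EFinP; exact: measurable_stop_at.
apply: ge0_le_integral => //.
- by move=> x _; rewrite mule_ge0 ?l_ge0.
- by apply: emeasurable_funM => //; exact: measurable_l.
- apply: emeasurable_funM => //; apply/measurable_EFinP.
  apply: measurable_sum => j; apply: measurable_funM.
    by case: (phi_rule n0) => mphi _ _; exact: mphi.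
  exact: measurable_decision_loss.
- by move=> x _; rewrite lee_wpmul2l// l_le_mean_loss.
Qed.

Hypothesis phi_optimal : forall j n, (0 < n)%N -> forall x,
  (phi j n x <= \1_[set z | (loss j n z)%:E = l_ n z] x)%R.

Lemma stopping_loss_eq_weighted_error :
  \sum_(1 <= n <oo) stopping_loss mu fH lambda psi n =
  \sum_(i < k) \sum_(j < k | i != j)
    (lambda i j)%:E * alpha X PH psi phi i j.
Proof.
rewrite weighted_error_series; apply: eq_eseries_ge1 => n n0.
apply: eq_integral => x _; congr (_ * _); rewrite [LHS]l_mean//.
congr EFin; apply: eq_bigr => j _.
have [<-//|/eqP not_min] := eqVneq (loss j n x)%:E (l_ n x).
suff -> : phi j n x = 0%R by rewrite !mul0r.
apply/eqP; rewrite eq_le phi_ge0// andbT.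
by rewrite (le_trans (phi_optimal j n0 x))// indicE memNset.
Qed.

End error_cost.

(** * The optimality theorem *)

Lemma weighted_beta (d d' : measure_display) (Omega : measurableType d)
    (T : measurableType d') (R : realType) (X : nat -> {mfun Omega >-> T})
    (k : nat) (PH : 'I_k -> probability Omega R) (lam : 'I_k -> R)
    (psi : seqfun T R) (phi : 'I_k -> seqfun T R) :
  (forall i j, 0 <= alpha X PH psi phi i j) ->
  \sum_(i < k) (lam i)%:E * beta X PH psi phi i =
  \sum_(i < k) \sum_(j < k | i != j) (lam i)%:E * alpha X PH psi phi i j.
Proof.
move=> alpha_ge0; apply: eq_bigr => i _; rewrite /beta ge0_sume_distrr//.
by apply: eq_bigl => j; rewrite eq_sym.
Qed.

Lemma sum_weighted_lt (R : realType) (k : nat) (lam : 'I_k -> R)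
    (b b' : 'I_k -> \bar R) (i : 'I_k) :
  (forall i, (0 < lam i)%R) -> (forall i, 0 <= b' i) ->
  (forall i, b' i <= b i) -> (forall i, b i < +oo) -> b' i < b i ->
  \sum_(i < k) (lam i)%:E * b' i < \sum_(i < k) (lam i)%:E * b i.
Proof.
move=> lam_gt0 b'0 b'b boo b'bi; rewrite (bigD1 i)//= [ltRHS](bigD1 i)//=.
apply: lte_leD.
- rewrite ge0_fin_numE; last first.
    by apply: sume_ge0 => j _; rewrite mule_ge0 ?lee_fin// ltW.
  apply: lte_sum_pinfty => j _; rewrite lte_mul_pinfty// ?lee_fin ?ltW//.
  exact: le_lt_trans (boo j).
- by rewrite lte_pmul2l ?lte_fin.
- by apply: lee_sum => j _; rewrite lee_wpmul2l// lee_fin ltW.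
Qed.

Unset Implicit Arguments.
Set Strict Implicit.

Theorem theorem8
    (R : realType)
    (d d' : measure_display) (Omega : measurableType d)
    (T : measurableType d')
    (* the process, its distributions and its densities *)
    (Theta : Type) (P : Theta -> probability Omega R)
    (X : nat -> {mfun Omega >-> T})
    (mu : {sigma_finite_measure set T -> \bar R})
    (f : Theta -> forall n : nat, n.-tuple T -> R)
    (f_density : forall (vartheta : Theta) (n : nat), (0 < n)%N ->
       has_density (P vartheta) (observations X n) (product_power mu n)
         (f vartheta n))
    (* the hypotheses H_i and the parameter of the average sample number *)
    (k : nat) (k_ge2 : (2 <= k)%N)
    (thetaH : 'I_k -> Theta) (theta : Theta)
    (lam : 'I_k -> R) (lam_gt0 : forall i, (0 < lam i)%R) :
  let PH := fun i => P (thetaH i) in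
  let fH := fun i => f (thetaH i) in
  let lambda := fun i _ : 'I_k => lam i in
  let N := average_sample_number X (P theta) in
  truncatable X (P theta) mu fH lambda ->
  forall (psi : forall n : nat, n.-tuple T -> R)
    (phi : 'I_k -> forall n : nat, n.-tuple T -> R),
  stopping_rule psi ->
  stopping_condition mu fH (f theta) lambda psi ->
  decision_rule phi ->
  (forall (j : 'I_k) (n : nat), (0 < n)%N -> forall x : n.-tuple T,
     (phi j n x <=
      \1_[set z | (decision_loss fH lambda j n z)%:E = l_ fH lambda n z] x)%R) ->
  forall (psi' : forall n : nat, n.-tuple T -> R)
    (phi' : 'I_k -> forall n : nat, n.-tuple T -> R),
  stopping_rule psi' -> decision_rule phi' ->
  (forall i, beta X PH psi' phi' i <= beta X PH psi phi i) ->
  [/\ N psi <= N psi',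
      (exists i, beta X PH psi' phi' i < beta X PH psi phi i) -> N psi < N psi'
    & (forall i, beta X PH psi' phi' i = beta X PH psi phi i) ->
      N psi' = N psi ->
      stopping_condition mu fH (f theta) lambda psi'].
Proof.
move=> PH fH lambda N trunc psi phi psi_rule cond phi_rule phi_opt.
move=> psi' phi' psi'_rule phi'_rule beta_le.
have k_gt0 : (0 < k)%N by exact: leq_trans k_ge2.
have lambda_ge0 i j : (0 <= lambda i j)%R by exact/ltW/lam_gt0.
have fH_density i n : (0 < n)%N ->
    has_density (PH i) (observations X n) (product_power mu n) (fH i n).
  exact: f_density.
pose S psi : \bar R := \sum_(1 <= n <oo) stopping_loss mu fH lambda psi n.
pose B psi phi : \bar R := \sum_(i < k) (lam i)%:E * beta X PH psi phi i.
(* The common lower bound for the cost of all tests. *)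
pose v := 1 + \int[product_power mu 1]_x V_ mu fH (f theta) lambda 1%N x.
have BE psi0 phi0 : stopping_rule psi0 -> decision_rule phi0 ->
    B psi0 phi0 = \sum_(i < k) \sum_(j < k | i != j)
      (lambda i j)%:E * alpha X PH psi0 phi0 i j.
  move=> r p; apply: weighted_beta => i j.
  exact: (alpha_ge0 fH_density r p).
have beta0 psi0 phi0 i : stopping_rule psi0 -> decision_rule phi0 ->
    0 <= beta X PH psi0 phi0 i.
  by move=> r p; exact: (beta_ge0 fH_density r p).
have vB : N psi + B psi phi = v.
  rewrite BE//.
  rewrite -(stopping_loss_eq_weighted_error k_gt0 lambda_ge0 fH_density
    psi_rule phi_rule phi_opt).
  apply/eqP; rewrite eq_le; apply/andP; split.
    exact: (cost_of_stopping_condition k_gt0 lambda_ge0 fH_density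
      (f_density theta) psi_rule cond).
  exact: (optimal_cost_le k_gt0 lambda_ge0 fH_density
    (f_density theta) psi_rule trunc).
have SB' : S psi' <= B psi' phi'.
  rewrite BE//; exact: (stopping_loss_le_weighted_error k_gt0 lambda_ge0
    fH_density psi'_rule phi'_rule).
have vS' : v <= N psi' + S psi'.
  exact: (optimal_cost_le k_gt0 lambda_ge0 fH_density
    (f_density theta) psi'_rule trunc).
have vB' : N psi + B psi phi <= N psi' + B psi' phi'.
  by rewrite vB; apply: (le_trans vS'); exact: leeD2l.
have voo : v < +oo.
  rewrite lte_add_pinfty ?ltry// -(continuation_value1 _ _ _ _ psi).
  exact: (continuation_value_lty k_gt0 lambda_ge0 fH_density
      (f_density theta) psi_rule).
have N0 : 0 <= N psi.
  rewrite /N average_sample_number_survival// nneseries_ge0// => n _ _.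
  exact: survival_ge0.
have N'0 : 0 <= N psi'.
  rewrite /N average_sample_number_survival// nneseries_ge0// => n _ _.
  exact: survival_ge0.
have wB_ge0 psi0 phi0 i : stopping_rule psi0 -> decision_rule phi0 ->
    0 <= (lam i)%:E * beta X PH psi0 phi0 i.
  by move=> r p; rewrite mule_ge0 ?beta0// lee_fin ltW.
have B0 : 0 <= B psi phi by apply: sume_ge0 => i _; exact: wB_ge0.
have B_fin : B psi phi \is a fin_num.
  by rewrite ge0_fin_numE// (le_lt_trans _ voo)// -vB leeDr.
have N_fin : N psi \is a fin_num.
  by rewrite ge0_fin_numE// (le_lt_trans _ voo)// -vB leeDl.
(* A positive multiplier would make an infinite error term visible in [B]. *)
have beta_lty i : beta X PH psi phi i < +oo.
  rewrite ltey; apply/eqP => beta_y; move: B_fin.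
  rewrite ge0_fin_numE// /B (bigD1 i)//= beta_y gt0_muley ?lte_fin// addye//.
  rewrite gt_eqF// (@lt_le_trans _ _ 0)// sume_ge0// => j _; exact: wB_ge0.
have B'B : B psi' phi' <= B psi phi.
  by apply: lee_sum => i _; rewrite lee_wpmul2l// lee_fin ltW.
split.
- by rewrite -(leeD2rE _ _ B_fin) (le_trans vB')// leeD2l.
- move=> [i beta_lt]; rewrite ltNge; apply/negP => NN.
  have : B psi' phi' < B psi phi.
    by apply: (@sum_weighted_lt _ _ _ _ _ i) => // j; exact: beta0.
  rewrite ltNge => /negP; apply; rewrite -(leeD2lE _ _ N_fin).
  by rewrite (le_trans vB')// leeD2r.
- move=> beta_eq N_eq.
  apply: (stopping_condition_of_cost k_gt0 lambda_ge0 fH_density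
    (f_density theta) psi'_rule trunc).
  rewrite -/(N psi') -/v -vB N_eq leeD2l//.
  apply: (le_trans SB'); rewrite le_eqVlt; apply/orP; left; apply/eqP.
  by apply: eq_bigr => i _; rewrite beta_eq.
Qed.
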